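(* Given $A\in\mathbb{R}^{m\times n}$ (of full row rank), with $W=\ker(A)$, there exists an $O(n^2m^2)$ time algorithm $\textsc{Find-Circuits}(A)$ that obtains a decomposition of $\mathcal M(A)$ into a direct sum of non-separable linear matroids, and returns a family $\hat{\mathcal C}$ of circuits such that if $i$ and $j$ are in the same non-separable component, then there exists a circuit in $\hat{\mathcal C}$ containing both $i$ and $j$. Further, for each $i\ne j$ in the same component, the algorithm returns a value $\hat\kappa_{ij}$ equal to the maximum of $|g_j/g_i|$ such that $g\in W$, $\mathrm{supp}(g)=C$ for some $C\in\hat{\mathcal C}$ containing $i$ and $j$. For these values, \[ \hat\kappa_{ij}\le\kappa_{ij}\le(\kappa^* )^2\hat\kappa_{ij}. \]
   Context: $\mathcal M(A)$ is the linear matroid on $[n]$ whose independent sets are the index sets of linearly independent columns of $A$; its circuits are the inclusion-wise minimal dependent sets. A matroid on $[n]$ is separable if $[n]$ can be partitioned into two nonempty sets $S,T$ such that a set $I$ is independent iff $I\cap S$ and $I\cap T$ are independent; it is then the direct sum of its restrictions to $S$ and $T$. Let $W=\ker(A)$ and let $\mathcal C_W$ be the set of circuits. For each $C\in\mathcal C_W$ there is $g^C\in W$ with $\mathrm{supp}(g^C)=C$, unique up to scaling. For $i,j\in[n]$, $\kappa_{ij}=\kappa^W_{ij}=\max\{|g^C_j|/|g^C_i|:C\in\mathcal C_W,\ i,j\in C\}$ ($0$ if no circuit contains $i,j$); $\kappa_W=\max_{i,j}\kappa^W_{ij}$; $\kappa^*=\kappa^*_W=\min\{\kappa_{DW}:D\text{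 a positive }n\times n\text{ diagonal matrix}\}$. Time is measured in the real model of computation (unit-cost arithmetic operations and comparisons on reals). *)

(* Defs.v *)
From mathcomp Require Import all_boot all_order all_algebra.
From mathcomp Require Import boolp classical_sets reals.
Set Implicit Arguments.
Unset Strict Implicit.
Unset Printing Implicit Defensive.
Import Order.TTheory GRing.Theory Num.Theory.
Local Open Scope ring_scope.

Record matroid (T : finType) := Matroid {
  ground : {set T};
  indep : {set T} -> bool;
  indep_ground : forall I, indep I -> I \subset ground;
  indep0 : indep finset.set0;
  indep_sub : forall I J : {set T}, I \subset J -> indep J -> indep I;
  indep_exchange : forall I J : {set T}, indep I -> indep J -> (#|I| < #|J|)%N ->
    exists2 x, x \in (J :\: I)%SET & indep (x |: I)%SET
}.

Section MatroidNotions.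
Variable T : finType.
Implicit Type M : matroid T.

Definition circuit M : {set T} -> bool :=
  minset [pred I : {set T} | (I \subset ground M) && ~~ indep M I].

Definition separable M : Prop :=
  exists S1 S2 : {set T},
    [/\ S1 != finset.set0, S2 != finset.set0, (S1 :|: S2)%SET = ground M,
        [disjoint S1 & S2] &
        forall I : {set T}, I \subset ground M ->
          indep M I = indep M (I :&: S1)%SET && indep M (I :&: S2)%SET].

Definition direct_sum M (P : {set {set T}}) (N : {set T} -> matroid T) : Prop :=
  [/\ finset.partition P (ground M),
      forall S, S \in P -> ground (N S) = S &
      forall I : {set T}, I \subset ground M ->
        indep M I = [forall S in P, indep (N S) (I :&: S)%SET]].

End MatroidNotions.

Section LinearMatroid.
Variables (F : fieldType) (m n : nat) (A : 'M[F]_(m, n)) (S : {set 'I_n}).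
Implicit Types I J : {set 'I_n}.

Definition free_cols I : bool := free [seq col j A | j in I].

Definition lin_indep I : bool := (I \subset S) && free_cols I.

Lemma lin_indep_ground I : lin_indep I -> I \subset S.
Proof. by case/andP. Qed.

Lemma lin_indep0 : lin_indep finset.set0.
Proof.
by rewrite /lin_indep finset.sub0set /free_cols /image_mem enum_set0 /= nil_free.
Qed.

Lemma lin_indep_sub I J : I \subset J -> lin_indep J -> lin_indep I.
Proof.
move=> sIJ /andP[sJS fJ]; rewrite /lin_indep (fintype.subset_trans sIJ sJS) /=.
have pJ : perm_eq (enum J) (enum I ++ enum (J :\: I)%SET).
  apply: uniq_perm; rewrite ?enum_uniq //.
    rewrite cat_uniq !enum_uniq andbT /=; apply/hasPn => x.
    by rewrite !mem_enum inE => /andP[].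
  move=> x; rewrite mem_cat !mem_enum inE.
  by have [/(fintype.subsetP sIJ)-> //|] := boolP (x \in I).
move: fJ; rewrite /free_cols /image_mem.
by rewrite (perm_free (perm_map _ pJ)) map_cat => /catl_free.
Qed.

Lemma lin_indep_exchange I J : lin_indep I -> lin_indep J ->
  (#|I| < #|J|)%N -> exists2 x, x \in (J :\: I)%SET & lin_indep (x |: I)%SET.
Proof.
move=> /andP[sIS fI] /andP[sJS fJ] ltIJ.
have [/existsP[x /andP[xJI xP]]|] :=
  boolP [exists x, (x \in J :\: I)%SET && lin_indep (x |: I)%SET].
  by exists x.
rewrite negb_exists => /forallP noX; exfalso.
pose cI := [seq col j A | j in I]; pose cJ := [seq col j A | j in J].
have sub : (<<cJ>> <= <<cI>>)%VS.
  apply/span_subvP => _ /fintype.imageP[x xJ ->].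
  have [xI|xI] := boolP (x \in I); first by rewrite memv_span // fintype.image_f.
  have := noX x; rewrite !inE xI xJ /= /lin_indep finset.subUset finset.sub1set.
  rewrite (fintype.subsetP sJS) // sIS /= /free_cols.
  have pI : perm_eq (enum (x |: I)%SET) (x :: enum I).
    apply: uniq_perm; rewrite /= ?enum_uniq ?mem_enum ?xI //.
    by move=> y; rewrite !inE !mem_enum !inE.
  rewrite /image_mem (perm_free (perm_map _ pI)) /= free_cons.
  by move: fI; rewrite /free_cols /image_mem => ->; rewrite andbT negbK.
have := dimvS sub; move: fI fJ; rewrite /free_cols /free => /eqP-> /eqP->.
by rewrite !size_map -!cardE leqNgt ltIJ.
Qed.

(** This is also the restriction to [S] of the matroid of [A], represented by the
    submatrix of the columns of [A] indexed by [S]. *)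
Definition linear_matroid : matroid 'I_n :=
  Matroid lin_indep_ground lin_indep0 lin_indep_sub lin_indep_exchange.

End LinearMatroid.

Definition matroid_of (F : fieldType) m n (A : 'M[F]_(m, n)) : matroid 'I_n :=
  linear_matroid A [set: 'I_n]%SET.

Section Imbalance.
Variables (R : realType) (n : nat).
Implicit Types (W : set 'cV[R]_n) (C : {set 'I_n}).

Definition ker m (A : 'M[R]_(m, n)) : set 'cV[R]_n :=
  [set g | A *m g = 0]%classic.

Definition supp (g : 'cV[R]_n) : {set 'I_n} := [set i | g i 0 != 0]%SET.

(** The circuits of [W] are those of the matroid of any matrix with kernel [W];
    they do not depend on that matrix. *)
Definition circuit_of W C : Prop :=
  exists m (A : 'M[R]_(m, n)), W = ker A /\ circuit (matroid_of A) C.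

(** A chosen vector of [W] with support [C]; for a circuit [C] of [W] it exists
    and is unique up to scaling, so ratios of its entries do not depend on the
    choice. *)
Definition circuit_vector W C : 'cV[R]_n :=
  xget 0 [set g | W g /\ supp g = C]%classic.

(** The default value [0] is the convention for an empty maximum; it does not
    affect the others, as all the ratios are nonnegative. *)
Definition kappa W (i j : 'I_n) : R :=
  \big[Num.max/0]_(C : {set 'I_n} | [&& `[< circuit_of W C >], i \in C & j \in C])
     (`|circuit_vector W C j 0| / `|circuit_vector W C i 0|).

Definition kappa_max W : R :=
  \big[Num.max/0]_(i < n) \big[Num.max/0]_(j < n) kappa W i j.

Definition rescale (d : 'rV[R]_n) W : set 'cV[R]_n :=
  [set diag_mx d *m g | g in W]%classic.

(** The infimum is the minimum whenever the latter is attained; no junk value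
    occurs, as the set is nonempty and bounded below by zero. *)
Definition kappa_star W : R :=
  inf [set kappa_max (rescale d W) | d in [set d : 'rV[R]_n | forall i, 0 < d 0 i]]%classic.

Definition is_maximum (E : set R) (x : R) : Prop := E x /\ ubound E x.

Definition imbalances W (Chat : seq {set 'I_n}) (i j : 'I_n) : set R :=
  [set x | exists g C, [/\ C \in Chat, i \in C, j \in C, W g /\ supp g = C
                         & x = `|g j 0 / g i 0|]]%classic.

End Imbalance.

(** The real model of computation: a while language over a random access memory
    with two kinds of cells, holding real numbers and natural numbers.  Natural
    numbers serve as indices and counters; a cell is addressed by a fixed array
    name and two computed indices.  Every operation, comparison, constant, memory
    read, memory write and branching has unit cost.  A program is a finite
    syntactic object that depends neither on the dimensions nor on the entries of
    the input. *)

Inductive nexpr :=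
| NConst of nat
| NRead of nat & nexpr & nexpr
| NAdd of nexpr & nexpr
| NSub of nexpr & nexpr.

(** [RDiv] by zero yields zero, as for division in the library; this gives no
    additional power since zero tests are available at unit cost. *)
Inductive rexpr :=
| RConst of nat
| RRead of nat & nexpr & nexpr
| RAdd of rexpr & rexpr
| RSub of rexpr & rexpr
| RMul of rexpr & rexpr
| RDiv of rexpr & rexpr.

Inductive bexpr :=
| NEq of nexpr & nexpr
| NLt of nexpr & nexpr
| REq of rexpr & rexpr
| RLt of rexpr & rexpr
| BNot of bexpr
| BAnd of bexpr & bexpr.

Inductive cmd :=
| Skip
| NWrite of nat & nexpr & nexpr & nexpr
| RWrite of nat & nexpr & nexpr & rexpr
| Seq of cmd & cmd
| If of bexpr & cmd & cmd
| While of bexpr & cmd.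

Fixpoint ncost (e : nexpr) : nat :=
  match e with
  | NConst _ => 1
  | NRead _ e1 e2 | NAdd e1 e2 | NSub e1 e2 => (ncost e1 + ncost e2).+1
  end.

Fixpoint rcost (e : rexpr) : nat :=
  match e with
  | RConst _ => 1
  | RRead _ e1 e2 => (ncost e1 + ncost e2).+1
  | RAdd e1 e2 | RSub e1 e2 | RMul e1 e2 | RDiv e1 e2 => (rcost e1 + rcost e2).+1
  end.

Fixpoint bcost (b : bexpr) : nat :=
  match b with
  | NEq e1 e2 | NLt e1 e2 => (ncost e1 + ncost e2).+1
  | REq e1 e2 | RLt e1 e2 => (rcost e1 + rcost e2).+1
  | BNot b1 => (bcost b1).+1
  | BAnd b1 b2 => (bcost b1 + bcost b2).+1
  end.

Section Semantics.
Variable R : realType.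

Record state := State {
  nmem : nat -> nat -> nat -> nat;
  rmem : nat -> nat -> nat -> R
}.

Implicit Type s : state.

Fixpoint neval s (e : nexpr) : nat :=
  match e with
  | NConst k => k
  | NRead a e1 e2 => nmem s a (neval s e1) (neval s e2)
  | NAdd e1 e2 => (neval s e1 + neval s e2)%N
  | NSub e1 e2 => (neval s e1 - neval s e2)%N
  end.

Fixpoint reval s (e : rexpr) : R :=
  match e with
  | RConst k => k%:R
  | RRead a e1 e2 => rmem s a (neval s e1) (neval s e2)
  | RAdd e1 e2 => reval s e1 + reval s e2
  | RSub e1 e2 => reval s e1 - reval s e2
  | RMul e1 e2 => reval s e1 * reval s e2
  | RDiv e1 e2 => reval s e1 / reval s e2
  end.

Fixpoint beval s (b : bexpr) : bool :=
  match b with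
  | NEq e1 e2 => neval s e1 == neval s e2
  | NLt e1 e2 => (neval s e1 < neval s e2)%N
  | REq e1 e2 => reval s e1 == reval s e2
  | RLt e1 e2 => reval s e1 < reval s e2
  | BNot b1 => ~~ beval s b1
  | BAnd b1 b2 => beval s b1 && beval s b2
  end.

Definition update (V : Type) (f : nat -> nat -> nat -> V) (a i j : nat) (v : V) :=
  fun a' i' j' => if [&& a' == a, i' == i & j' == j] then v else f a' i' j'.

(** [exec c s t s'] : started in state [s], the program [c] halts in state [s']
    after [t] unit-cost steps. *)
Inductive exec : cmd -> state -> nat -> state -> Prop :=
| exec_skip s : exec Skip s 1 s
| exec_nwrite a e1 e2 e s :
    exec (NWrite a e1 e2 e) s (ncost e1 + ncost e2 + ncost e).+1
      (State (update (nmem s) a (neval s e1) (neval s e2) (neval s e)) (rmem s))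
| exec_rwrite a e1 e2 e s :
    exec (RWrite a e1 e2 e) s (ncost e1 + ncost e2 + rcost e).+1
      (State (nmem s) (update (rmem s) a (neval s e1) (neval s e2) (reval s e)))
| exec_seq c1 c2 s t1 s1 t2 s2 :
    exec c1 s t1 s1 -> exec c2 s1 t2 s2 -> exec (Seq c1 c2) s (t1 + t2) s2
| exec_if b c1 c2 s t s' :
    exec (if beval s b then c1 else c2) s t s' ->
    exec (If b c1 c2) s (bcost b + t).+1 s'
| exec_while_false b c s :
    ~~ beval s b -> exec (While b c) s (bcost b).+1 s
| exec_while_true b c s t1 s1 t2 s2 :
    beval s b -> exec c s t1 s1 -> exec (While b c) s1 t2 s2 ->
    exec (While b c) s (bcost b + t1 + t2).+1 s2.

(** Input: [m] and [n] are in cells [(0, 0)] and [(0, 1)] of the natural number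
    array [0], [A] is in the real array [0], and all other cells are zero. *)
Definition input m n (A : 'M[R]_(m, n)) : state :=
  State
    (fun a i j => if [&& a == 0, i == 0 & j == 0]%N then m
                  else if [&& a == 0, i == 0 & j == 1]%N then n else 0%N)
    (fun a i j => match a, insub i : option 'I_m, insub j : option 'I_n with
                  | 0%N, Some i', Some j' => A i' j'
                  | _, _, _ => 0
                  end).

(** Output: a label for each [j], with the components as the classes of equally
    labelled indices; the number of circuits, the size of each circuit and the
    list of its elements; the table of the values for pairs of indices. *)
Definition returns_components s n (P : {set {set 'I_n}}) : Prop :=
  P = preim_partition (fun j : 'I_n => nmem s 1 0 j) [set: 'I_n]%SET.

Definition returns_family s n (Chat : seq {set 'I_n}) : Prop :=
  nmem s 2 0 0 = size Chat /\
  forall k, (k < size Chat)%N ->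
    perm_eq [seq nmem s 4 k l | l <- iota 0 (nmem s 3 0 k)]
            [seq val j | j in nth finset.set0 Chat k].

Definition returns_table s n (K : 'I_n -> 'I_n -> R) : Prop :=
  forall i j : 'I_n, K i j = rmem s 1 i j.

End Semantics.

(* Main.v *)
Require Import Defs.
From mathcomp Require Import all_boot all_order all_algebra.
From mathcomp Require Import boolp classical_sets reals.
From mathcomp Require Import zify ring.
Set Implicit Arguments.
Unset Strict Implicit.
Unset Printing Implicit Defensive.
Import Order.TTheory GRing.Theory Num.Theory.
Local Open Scope ring_scope.

(** Let [T] be the reduced form of [A] obtained by Gauss-Jordan elimination; it
    has the same kernel [W], and the columns of a basis [B] are unit vectors in
    it.  Call two indices linked when they are joined by a chain in which any two
    consecutive indices are nonzero in a common row of [T].  Restricting a vector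
    of [W] to a class of linked indices stays in [W], because each row of [T]
    lives in a single class ([restrict_ker]); hence the matroid is the direct sum
    of its restrictions to the classes.  No class is separable once any two of its elements lie on a
    common circuit ([component_nonseparable]).

    The circuits come from one search for each source [i].  The search keeps, for
    every index [v] reached so far, a basis of [m] columns and the expression of
    the column of [v] in it, in such a way that [i] takes part in this relation.
    The relation of an element with a basis is unique up to scaling, so its
    support is a circuit ([node_elementary]); it contains [i] and [v].  The search
    advances by pivoting: if row [b] has not been used and the relation of [p]
    involves the element of slot [b], then every unreached [v] with [T b v]
    nonzero gets the basis of [p] in which [p] replaces this element.  The key
    point is that this costs [O(m)] and not [O(m n)]: all nonzero columns of a
    used row have already been reached, so the column of [v] is zero in the used
    rows, and in the other rows the basis of [p] still has its original unit
    vectors ([node_step]).  When no row can be used any more, the reached indices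
    are exactly the class of [i] ([search_end]).

    Each search makes at most [m] steps, found by inspecting all [m n] pairs of a
    row and a reached index; each of the at most [n] circuits it yields has at
    most [m + 1] elements, whose [(m + 1) ^ 2] pairs update the table.  Over the
    [n] sources this is [O(n ^ 2 m ^ 2)].  The programs are written with bounded
    loops, for which such a count is just the nesting of the loops
    ([compile_exec]), and their correctness is proved separately on a total
    semantics.

    The bound on the imbalances follows by scaling: a positive diagonal matrix
    multiplies the ratios of the entries [j] and [i] of all elementary vectors by
    the same number, which cancels between the vector that attains [kappa i j] and
    the one that attains the computed value ([kappa_max_rescale]). *)

(** * Programs with bounded loops *)

(** The loop bounds [m], [n] and [m + 1]; the last one is the number of columns
    in a basis together with one more column. *)
Inductive dim := Rows | Cols | Slots.

Definition cell a i j := NRead a (NConst i) (NConst j).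
Definition var a := cell a 0 0.

Definition dim_expr d :=
  match d with
  | Rows => cell 0 0 0
  | Cols => cell 0 0 1
  | Slots => NAdd (cell 0 0 0) (NConst 1)
  end.

Definition dim_val m n d : nat :=
  match d with Rows => m | Cols => n | Slots => m.+1 end.

(** The fragment of the while language in which the loops have bounds fixed on
    entry: every program denotes a total function on states. *)
Inductive prog :=
| SetN of nat & nexpr & nexpr & nexpr
| SetR of nat & nexpr & nexpr & rexpr
| Then of prog & prog
| When of bexpr & prog
| For of nat & dim & prog.

Fixpoint compile p : cmd :=
  match p with
  | SetN a e1 e2 e => NWrite a e1 e2 e
  | SetR a e1 e2 e => RWrite a e1 e2 e
  | Then p q => Seq (compile p) (compile q)
  | When b p => If b (compile p) Skip
  | For v d p =>
      Seq (NWrite v (NConst 0) (NConst 0) (NConst 0))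
          (While (NLt (var v) (dim_expr d))
             (Seq (compile p)
                (NWrite v (NConst 0) (NConst 0) (NAdd (var v) (NConst 1)))))
  end.

Fixpoint writesN p : seq nat :=
  match p with
  | SetN a _ _ _ => [:: a]
  | SetR _ _ _ _ => [::]
  | Then p q => writesN p ++ writesN q
  | When _ p => writesN p
  | For v _ p => v :: writesN p
  end.

Fixpoint writesR p : seq nat :=
  match p with
  | SetN _ _ _ _ => [::]
  | SetR a _ _ _ => [:: a]
  | Then p q => writesR p ++ writesR q
  | When _ p => writesR p
  | For _ _ p => writesR p
  end.

(** Loop counters and the dimensions are left alone by the loop bodies: this is
    what makes every loop a bounded one. *)
Fixpoint wf p : bool :=
  match p with
  | SetN _ _ _ _ | SetR _ _ _ _ => true
  | Then p q => wf p && wf q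
  | When _ p => wf p
  | For v _ p => [&& wf p, v != 0%N, 0%N \notin writesN p & v \notin writesN p]
  end.

(** The time is at most [coef p * ((n + 1) ^ degC p * (m + 1) ^ degR p)].  The
    overhead of a loop is at most 26 steps for each pass and 14 steps once. *)
Fixpoint coef p : nat :=
  match p with
  | SetN _ e1 e2 e => (ncost e1 + ncost e2 + ncost e).+1
  | SetR _ e1 e2 e => (ncost e1 + ncost e2 + rcost e).+1
  | Then p q => coef p + coef q
  | When b p => (bcost b + (coef p).+1).+1
  | For _ _ p => coef p + 40
  end.

Fixpoint degR p : nat :=
  match p with
  | SetN _ _ _ _ | SetR _ _ _ _ => 0
  | Then p q => maxn (degR p) (degR q)
  | When _ p => degR p
  | For _ d p => (if d is Cols then 0 else 1) + degR p
  end.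

Fixpoint degC p : nat :=
  match p with
  | SetN _ _ _ _ | SetR _ _ _ _ => 0
  | Then p q => maxn (degC p) (degC q)
  | When _ p => degC p
  | For _ d p => (if d is Cols then 1 else 0) + degC p
  end.

Section Run.
Variable R : realType.
Implicit Types s : state R.

Definition storeN a i j x s := State (update (nmem s) a i j x) (rmem s).
Definition storeR a i j x s := State (nmem s) (update (rmem s) a i j x).

Fixpoint run p s : state R :=
  match p with
  | SetN a e1 e2 e => storeN a (neval s e1) (neval s e2) (neval s e) s
  | SetR a e1 e2 e => storeR a (neval s e1) (neval s e2) (reval s e) s
  | Then p q => run q (run p s)
  | When b p => if beval s b then run p s else s
  | For v d p =>
      iteri (neval s (dim_expr d)) (fun k s' => storeN v 0 0 k.+1 (run p s'))
        (storeN v 0 0 0 s)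
  end.

Lemma updateE (V : Type) (f : nat -> nat -> nat -> V) a i j v a' i' j' :
  update f a i j v a' i' j' = if [&& a' == a, i' == i & j' == j] then v else f a' i' j'.
Proof. by []. Qed.

Lemma update_other (V : Type) (f : nat -> nat -> nat -> V) a i j v a' :
  a' != a -> update f a i j v a' = f a'.
Proof. by move=> h; rewrite /update (negbTE h). Qed.

Lemma run_frameN p s a : a \notin writesN p -> nmem (run p s) a = nmem s a.
Proof.
elim: p s => [b e1 e2 e|b e1 e2 e|p IHp q IHq|b p IHp|v d p IHp] s //=.
- by rewrite inE => h; rewrite update_other.
- by rewrite mem_cat negb_or => /andP[hp hq]; rewrite IHq ?IHp.
- by case: ifP => // _; apply: IHp.
- rewrite inE negb_or => /andP[hv hp].
  elim: (neval _ _) => [|k IHk] /=; first by rewrite update_other.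
  by rewrite update_other // IHp.
Qed.

Lemma run_frameR p s a : a \notin writesR p -> rmem (run p s) a = rmem s a.
Proof.
elim: p s => [b e1 e2 e|b e1 e2 e|p IHp q IHq|b p IHp|v d p IHp] s //=.
- by rewrite inE => h; rewrite update_other.
- by rewrite mem_cat negb_or => /andP[hp hq]; rewrite IHq ?IHp.
- by case: ifP => // _; apply: IHp.
- by move=> hp; elim: (neval _ _) => [|k IHk] //=; rewrite IHp.
Qed.

Definition has_dims m n s := nmem s 0 0 0 = m /\ nmem s 0 0 1 = n.

Lemma dimE m n s d : has_dims m n s -> neval s (dim_expr d) = dim_val m n d.
Proof. by case=> h1 h2; case: d => /=; rewrite ?h1 ?h2 ?addn1. Qed.

(** Invariants need to speak only of the arrays that the loop writes: the step
    gets the contents of all the others from the syntax of the body. *)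
Lemma run_for (Inv : nat -> state R -> Prop) m n v d p s :
  has_dims m n s -> v \notin writesN p ->
  Inv 0 (storeN v 0 0 0 s) ->
  (forall k s', (k < dim_val m n d)%N ->
     (forall a, a \notin v :: writesN p -> nmem s' a = nmem s a) ->
     (forall a, a \notin writesR p -> rmem s' a = rmem s a) ->
     nmem s' v 0 0 = k -> Inv k s' -> Inv k.+1 (storeN v 0 0 k.+1 (run p s'))) ->
  Inv (dim_val m n d) (run (For v d p) s).
Proof.
move=> hd hv h0 hS /=; rewrite (dimE _ hd).
set F := (X in iteri _ X _); set s0 := storeN _ _ _ _ s.
suff H k : (k <= dim_val m n d)%N ->
    [/\ forall a, a \notin v :: writesN p -> nmem (iteri k F s0) a = nmem s a,
        forall a, a \notin writesR p -> rmem (iteri k F s0) a = rmem s a,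
        nmem (iteri k F s0) v 0 0 = k & Inv k (iteri k F s0)].
  by case: (H _ (leqnn _)).
elim: k => [|k IHk] hk /=.
  split=> // [a|]; last by rewrite /update !eqxx.
  by rewrite inE negb_or => /andP[ha _]; rewrite update_other.
have [h1 h2 h3 h4] := IHk (ltnW hk).
split=> //.
- move=> a ha; have := ha; rewrite inE negb_or => /andP[hav hap].
  by rewrite update_other // run_frameN // h1.
- by move=> a ha; rewrite run_frameR // h2.
- by rewrite /update !eqxx.
- exact: hS.
Qed.

Lemma run_dims m n p s :
  0%N \notin writesN p -> has_dims m n s -> has_dims m n (run p s).
Proof. by move=> hp; rewrite /has_dims run_frameN. Qed.

Lemma expn_mono a b c d m n : (a <= c)%N -> (b <= d)%N ->
  (n.+1 ^ a * m.+1 ^ b <= n.+1 ^ c * m.+1 ^ d)%N.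
Proof. by move=> h1 h2; rewrite leq_mul // leq_pexp2l. Qed.

(** The bound [m + 1] of [Slots] is one more than [m], whence the successor. *)
Lemma dim_val_le m n d : (dim_val m n d <= (if d is Cols then n else m).+1)%N.
Proof. by case: d => /=. Qed.

Lemma compile_exec m n p s : wf p -> 0%N \notin writesN p -> has_dims m n s ->
  exists t, exec (compile p) s t (run p s) /\
    (t <= coef p * (n.+1 ^ degC p * m.+1 ^ degR p))%N.
Proof.
elim: p s => [a e1 e2 e|a e1 e2 e|p IHp q IHq|b p IHp|v d p IHp] s /=.
- by move=> _ _ _; eexists; split; [exact: exec_nwrite|rewrite !expn0 !muln1].
- by move=> _ _ _; eexists; split; [exact: exec_rwrite|rewrite !expn0 !muln1].
- move=> /andP[wp wq]; rewrite mem_cat negb_or => /andP[p0 q0] hd.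
  have [t1 [e1 l1]] := IHp _ wp p0 hd.
  have [t2 [e2 l2]] := IHq _ wq q0 (run_dims p0 hd).
  exists (t1 + t2)%N; split; first exact: exec_seq e1 e2.
  rewrite mulnDl leq_add // ?(leq_trans l1) ?(leq_trans l2) //.
    by rewrite leq_mul // expn_mono // leq_maxl.
  by rewrite leq_mul // expn_mono // leq_maxr.
- move=> wp p0 hd; have [t [e l]] := IHp _ wp p0 hd.
  have Y0 : (0 < n.+1 ^ degC p * m.+1 ^ degR p)%N by rewrite muln_gt0 !expn_gt0.
  move: (n.+1 ^ _ * _)%N l Y0 => Y l Y0.
  case: ifP => hb.
    exists (bcost b + t).+1; split; first by apply: exec_if; rewrite hb.
    nia.
  exists (bcost b + 1).+1; split.
    by apply: exec_if; rewrite hb; apply: exec_skip.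
  nia.
move=> /and4P[wp v0 p0 vp] _ hd.
set F := (X in iteri _ X _); set s0 := storeN v 0 0 0 s.
rewrite (dimE d hd).
set N := dim_val m n d; set Y := (n.+1 ^ degC p * m.+1 ^ degR p)%N.
have Y0 : (0 < Y)%N by rewrite muln_gt0 !expn_gt0.
have hk k : has_dims m n (iteri k F s0) /\ nmem (iteri k F s0) v 0 0 = k.
  elim: k => [|k [IH1 IH2]] /=.
    split; first by rewrite /has_dims /= !update_other // eq_sym.
    by rewrite /= /update !eqxx.
  split; last by rewrite /update !eqxx.
  have [h1 h2] := run_dims p0 IH1.
  by rewrite /has_dims /= !update_other // eq_sym.
set W := While _ _.
have cd : (ncost (dim_expr d) <= 5)%N by case: (d).
have hW k : (k <= N)%N -> exists t, exec W (iteri (N - k) F s0) t (iteri N F s0) /\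
    (t <= k * (coef p * Y + 26) + 10)%N.
  elim: k => [_|k IHk lk].
    rewrite subn0; have [h1 h2] := hk N.
    eexists; split.
      by apply: exec_while_false; rewrite /= h2 (dimE d h1) ltnn.
    by rewrite /=; lia.
  have [t2 [e2 l2]] := IHk (ltnW lk).
  have [h1 h2] := hk (N - k.+1)%N.
  have [t1 [e1 l1]] := IHp _ wp p0 h1.
  rewrite -/Y in l1.
  eexists; split.
    apply: exec_while_true; last exact: e2.
      by rewrite /= h2 (dimE d h1) -/N; lia.
    rewrite -(subnSK lk); apply: exec_seq; first exact: e1.
    have := exec_nwrite v (NConst 0) (NConst 0) (NAdd (var v) (NConst 1))
      (run p (iteri (N - k.+1) F s0)).
    by rewrite /= run_frameN // h2 [(_ - _ + 1)%N]addn1 => h; exact: h.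
  rewrite mulSn; move: l2 l1 cd; rewrite /=; move: (_ * (_ + 26))%N => Z.
  by lia.
have [t [e l]] := hW _ (leqnn N).
rewrite subnn in e.
eexists; split; first by apply: exec_seq; [exact: exec_nwrite|exact: e].
rewrite /=.
(* the bound on the number of passes is absorbed by one more factor [n + 1] or
   [m + 1] *)
set Z := (n.+1 ^ _ * m.+1 ^ _)%N.
have [hN hY] : (N * Y <= Z)%N /\ (Y <= Z)%N.
  have h := dim_val_le m n d; rewrite -/N in h.
  rewrite /Z !expnD /Y; move: (_ ^ degC p)%N (_ ^ degR p)%N => a b.
  split; last by case: (d); rewrite ?expn0 ?expn1 ?mul1n; nia.
  apply: leq_trans (leq_mul h (leqnn _)) _.
  by case: (d) => /=; rewrite ?expn0 ?expn1 ?mul1n; nia.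
apply: leq_trans (_ : N * (coef p * Y) + N * 26 + 14 <= _)%N; first by lia.
rewrite mulnDl mulnCA; have := leq_mul (leqnn (coef p)) hN; nia.
Qed.
End Run.

(** * Elementary vectors and circuits *)

Section Elementary.
Variables (R : realType) (n : nat).
Implicit Types (W : set 'cV[R]_n) (C I : {set 'I_n}) (g h : 'cV[R]_n).

Lemma in_supp g i : (i \in supp g) = (g i 0 != 0).
Proof. by rewrite inE. Qed.

Lemma supp_neq0 g : (g != 0) = (supp g != finset.set0).
Proof.
apply/idP/idP => [|/finset.set0Pn[i]].
  apply: contraNneq => h; apply/eqP/matrixP => i j; rewrite ord1 mxE.
  by apply/eqP; apply: contraT; rewrite -in_supp h finset.in_set0.
by rewrite in_supp; apply: contraNneq => ->; rewrite mxE.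
Qed.

(** The vectors of minimal support of a subspace, in a form that includes the
    uniqueness up to scaling. *)
Definition elementary W g :=
  [/\ W g, g != 0 & forall h, W h -> supp h \subset supp g -> exists a, h = a *: g].

Lemma mulmx_col m (A : 'M[R]_(m, n)) g : A *m g = \sum_i g i 0 *: col i A.
Proof.
apply/matrixP => q j; rewrite ord1 mxE summxE; apply: eq_bigr => i _.
by rewrite !mxE mulrC.
Qed.

Lemma free_colsP m (A : 'M[R]_(m, n)) I :
  (forall g, ker A g -> supp g \subset I -> g = 0) <-> free_cols A I.
Proof.
pose X := image_tuple (fun j => col j A) I.
change (free_cols A I) with (free X).
have E (k : 'I_#|I| -> R) : \sum_(i < #|I|) k i *: X`_i =
    A *m (\sum_(i < #|I|) k i *: delta_mx (enum_val i) 0).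
  rewrite mulmx_sumr; apply: eq_bigr => i _.
  by rewrite -scalemxAr -colE nth_image.
have G (k : 'I_#|I| -> R) i :
    (\sum_(i < #|I|) k i *: delta_mx (enum_val i) 0 : 'cV[R]_n) (enum_val i) 0 = k i.
  rewrite summxE (bigD1 i) //= big1 => [|j ji]; rewrite !mxE ?eqxx ?addr0 ?mulr1 //.
  by rewrite (inj_eq enum_val_inj) eq_sym (negbTE ji) mulr0.
split=> [H|hf g].
  suff /freeP : forall k : 'I_#|I| -> R,
      \sum_(i < #|I|) k i *: X`_i = 0 ->
      forall i, k i = 0 by [].
  move=> k hk i; rewrite -(G k i) (H (\sum_(i < #|I|) _)) ?mxE //.
    by rewrite /ker /= -E.
  apply/fintype.subsetP => j; rewrite in_supp summxE; apply: contraR => jI.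
  rewrite big1 // => l _; rewrite !mxE; case: eqP => [jl|_]; last by rewrite mulr0.
  by rewrite jl enum_valP in jI.
move/freeP: hf => H.
rewrite /ker /= mulmx_col => hg sg.
have hI : \sum_(i < #|I|) g (enum_val i) 0 *: X`_i = 0.
  rewrite -[RHS]hg [RHS](bigID (mem I)) /= [X in _ + X]big1 ?addr0 => [|i iI].
    rewrite [RHS]big_enum_val; apply: eq_bigr => i _; by rewrite nth_image.
  suff -> : g i 0 = 0 by rewrite scale0r.
  by apply: contraNeq iI; rewrite -in_supp; apply: (fintype.subsetP sg).
apply/eqP; apply: contraT; rewrite supp_neq0 => /finset.set0Pn[i hi].
have iI := fintype.subsetP sg _ hi.
move: hi; rewrite in_supp -(enum_rankK_in iI iI).
by rewrite (H (fun i => g (enum_val i) 0)) ?eqxx.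
Qed.

Lemma supp_scale a g : a != 0 -> supp (a *: g) = supp g.
Proof. by move=> a0; apply/finset.setP => i; rewrite !in_supp mxE mulf_eq0 (negbTE a0). Qed.

Lemma ker_lin m (A : 'M[R]_(m, n)) a g h :
  ker A g -> ker A h -> ker A (h - a *: g).
Proof. by rewrite /ker /= => hg hh; rewrite mulmxBr -scalemxAr hg hh scaler0 subr0. Qed.

Lemma dependentP m (A : 'M[R]_(m, n)) I :
  ~~ indep (matroid_of A) I <-> exists g, [/\ ker A g, g != 0 & supp g \subset I].
Proof.
rewrite /= /lin_indep finset.subsetT /=; split=> [hI|[g [kg g0 gI]]].
  apply: contrapT => hN; move/negP: hI; apply; apply/free_colsP => g kg gI.
  by apply/eqP; apply: contraT => g0; case: hN; exists g.
by apply/negP => /free_colsP/(_ g kg gI) /eqP; rewrite (negbTE g0).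
Qed.

Lemma circuitP m (A : 'M[R]_(m, n)) C :
  circuit (matroid_of A) C <-> exists2 g, elementary (ker A) g & supp g = C.
Proof.
split.
  case/minsetP => /andP[_ /dependentP[g [kg g0 gC]]] minC.
  have dep h : ker A h -> h != 0 -> supp h \subset C -> supp h = C.
    move=> kh h0 hC; apply: minC => //; rewrite /= finset.subsetT /=.
    by apply/dependentP; exists h.
  have sg : supp g = C by apply: dep.
  exists g => //; split=> // h kh hg.
  move: (g0); rewrite supp_neq0 => /finset.set0Pn[i ig].
  exists (h i 0 / g i 0); apply/eqP; rewrite -subr_eq0; apply: contraT => d0.
  have sd : supp (h - (h i 0 / g i 0) *: g) \subset C.
    rewrite -sg; apply/fintype.subsetP => j; rewrite !in_supp; apply: contraNneq => gj.
    rewrite !mxE gj mulr0 subr0; apply: contraT; rewrite -in_supp.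
    by move=> /(fintype.subsetP hg); rewrite in_supp gj eqxx.
  have := dep _ (ker_lin _ kg kh) d0 sd; rewrite -sg => /finset.setP/(_ i).
  by rewrite ig in_supp !mxE divfK ?subrr ?eqxx // -in_supp.
case=> g [kg g0 hg] <-; apply/minsetP; split=> [|J /andP[_ /dependentP]].
  by rewrite /= finset.subsetT /=; apply/dependentP; exists g.
case=> h [kh h0 hJ] Jg.
have [a ha] := hg h kh (fintype.subset_trans hJ Jg).
have a0 : a != 0 by apply: contraNneq h0 => a0; rewrite ha a0 scale0r.
by apply/eqP; rewrite finset.eqEsubset Jg -(supp_scale g a0) -ha.
Qed.

Lemma elementary_ratio W g h i j : elementary W g -> W h -> supp h = supp g ->
  h i 0 != 0 -> h j 0 / h i 0 = g j 0 / g i 0.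
Proof.
case=> _ _ u Wh sh hi; have [|a ha] := u h Wh; first by rewrite sh.
have a0 : a != 0 by apply: contraNneq hi => a0; rewrite ha a0 scale0r mxE.
by rewrite ha !mxE -mulf_div divff // mul1r.
Qed.

Lemma elementary_circuit_of m (A : 'M[R]_(m, n)) g :
  elementary (ker A) g -> circuit_of (ker A) (supp g).
Proof. by move=> eg; exists m, A; split=> //; apply/circuitP; exists g. Qed.

Lemma circuit_vectorP W C : circuit_of W C ->
  exists g, [/\ elementary W g, supp g = C, W (circuit_vector W C) &
                supp (circuit_vector W C) = C].
Proof.
case=> m [A [-> /circuitP[g eg sg]]]; exists g.
have [kg _ _] := eg.
have [] : [set h | ker A h /\ supp h = C]%classic (circuit_vector (ker A) C).
  by apply: xgetPex; exists g.
by [].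
Qed.

Lemma kappa_ge m (A : 'M[R]_(m, n)) g i j :
  elementary (ker A) g -> g i 0 != 0 -> g j 0 != 0 ->
  `|g j 0 / g i 0| <= kappa (ker A) i j.
Proof.
move=> eg gi gj; have cC := elementary_circuit_of eg.
have [h [eh sh Wv sv]] := circuit_vectorP cC.
have vi : circuit_vector (ker A) (supp g) i 0 != 0 by rewrite -in_supp sv in_supp.
rewrite -(elementary_ratio j eg Wv sv vi) normf_div.
apply: (@le_bigmax_cond _ _ _ 0 (supp g)
  (fun C => [&& `[< circuit_of (ker A) C >], i \in C & j \in C])
  (fun C => `|circuit_vector (ker A) C j 0| / `|circuit_vector (ker A) C i 0|)).
by rewrite !in_supp gi gj !andbT; apply/asboolP.
Qed.

Lemma kappa_le W i j M : 0 <= M ->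
  (forall g, elementary W g -> g i 0 != 0 -> g j 0 != 0 -> `|g j 0 / g i 0| <= M) ->
  kappa W i j <= M.
Proof.
move=> M0 hM; apply: bigmax_le => // C /and3P[/asboolP cC iC jC].
have [g [eg sg Wv sv]] := circuit_vectorP cC.
have vi : circuit_vector W C i 0 != 0 by rewrite -in_supp sv.
rewrite -normf_div (elementary_ratio j eg Wv) ?sv //.
by apply: hM => //; rewrite -in_supp sg.
Qed.

Lemma kappa_max_ge W i j : kappa W i j <= kappa_max W.
Proof.
apply: le_trans (le_bigmax _ _ j) _.
exact: (le_bigmax _ (fun i => \big[Num.max/0]_(j < n) kappa W i j) i).
Qed.

Section Rescale.
Variables (m : nat) (A : 'M[R]_(m, n)) (d : 'rV[R]_n).
Hypothesis d0 : forall i, 0 < d 0 i.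

Let dinv : 'rV[R]_n := \row_i (d 0 i)^-1.

Let d_neq0 i : d 0 i != 0. Proof. by rewrite gt_eqF. Qed.

Let diagE (e : 'rV[R]_n) g i : (diag_mx e *m g) i 0 = e 0 i * g i 0.
Proof. by rewrite mul_diag_mx mxE. Qed.

Let dK g : diag_mx dinv *m (diag_mx d *m g) = g.
Proof. by apply/matrixP => i j; rewrite ord1 !diagE mxE mulKf. Qed.

Let dVK g : diag_mx d *m (diag_mx dinv *m g) = g.
Proof. by apply/matrixP => i j; rewrite ord1 !diagE mxE mulVKf. Qed.

Lemma rescale_ker : rescale d (ker A) = ker (A *m diag_mx dinv).
Proof.
apply/seteqP; split=> [_ [g /= kg <-]|g /= kg].
  by rewrite /ker /= -mulmxA dK.
by exists (diag_mx dinv *m g); rewrite /= ?dVK // /ker /= mulmxA.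
Qed.

Lemma elementary_rescale g : elementary (ker A) g ->
  elementary (rescale d (ker A)) (diag_mx d *m g).
Proof.
case=> kg g0 hg; have sD h : supp (diag_mx d *m h) = supp h.
  by apply/finset.setP => i; rewrite !in_supp diagE mulf_eq0 (negbTE (d_neq0 i)).
split; first by exists g.
  by rewrite supp_neq0 sD -supp_neq0.
move=> _ [h kh <-]; rewrite !sD => /(hg h kh)[a ->]; exists a.
by rewrite -scalemxAr.
Qed.

(** Rescaling multiplies the ratio of the entries [j] and [i] of every
    elementary vector by the same factor [d j / d i].  In the rescaled space the
    ratio [j] to [i] of [g] and the ratio [i] to [j] of [h] are both at most
    [kappa_max]; the factor cancels in their product. *)
Lemma kappa_max_rescale g h i j : elementary (ker A) g -> elementary (ker A) h ->
  g i 0 != 0 -> g j 0 != 0 -> h i 0 != 0 -> h j 0 != 0 ->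
  `|g j 0 / g i 0| <= kappa_max (rescale d (ker A)) ^+ 2 * `|h j 0 / h i 0|.
Proof.
move=> eg eh gi gj hi hj; set k := kappa_max _.
have bound u a b : elementary (ker A) u -> u a 0 != 0 -> u b 0 != 0 ->
    d 0 b / d 0 a * `|u b 0 / u a 0| <= k.
  move=> eu ua ub; have := elementary_rescale eu; rewrite rescale_ker => eD.
  have := kappa_ge (i := a) (j := b) eD.
  rewrite !diagE !mulf_neq0 // -mulf_div normrM gtr0_norm ?divr_gt0 // => /(_ isT isT).
  by rewrite -rescale_ker => /le_trans; apply; apply: kappa_max_ge.
have B1 := bound g i j eg gi gj; have B2 := bound h j i eh hj hi.
have hp : 0 < `|h j 0 / h i 0| by rewrite normr_gt0 mulf_neq0 // invr_eq0.
have k0 : 0 <= k by apply: le_trans B1; rewrite mulr_ge0 // ltW // divr_gt0.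
have pos a b (u : 'cV[R]_n) : 0 <= d 0 b / d 0 a * `|u b 0 / u a 0|.
  by rewrite mulr_ge0 // ltW // divr_gt0.
have := ler_pM (pos i j g) (pos j i h) B1 B2.
have -> : d 0 j / d 0 i * `|g j 0 / g i 0| * (d 0 i / d 0 j * `|h i 0 / h j 0|) =
    `|g j 0 / g i 0| / `|h j 0 / h i 0|.
  rewrite !normf_div; field.
  by rewrite !normr_eq0 hi hj gi !d_neq0.
by rewrite ler_pdivrMr // expr2.
Qed.

End Rescale.

(** The bound by [kappa_max] holds for every rescaling; taking square roots turns
    it into a lower bound of the set whose infimum is [kappa_star]. *)
Lemma kappa_star_bound m (A : 'M[R]_(m, n)) h i j :
  elementary (ker A) h -> h i 0 != 0 -> h j 0 != 0 ->
  kappa (ker A) i j <= kappa_star (ker A) ^+ 2 * `|h j 0 / h i 0|.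
Proof.
move=> eh hi hj; have hp : 0 < `|h j 0 / h i 0|.
  by rewrite normr_gt0 mulf_neq0 // invr_eq0.
apply: kappa_le => [|g eg gi gj]; first by rewrite mulr_ge0 ?sqr_ge0 // ltW.
rewrite -ler_pdivrMr //; set q := _ / _.
have q0 : 0 <= q by rewrite divr_ge0.
suff hq : Num.sqrt q <= kappa_star (ker A).
  by rewrite -(sqr_sqrtr q0) lerXn2r // nnegrE ?sqrtr_ge0 // (le_trans _ hq) ?sqrtr_ge0.
apply: lb_le_inf.
  by exists (kappa_max (rescale (const_mx 1) (ker A))), (const_mx 1) => // k; rewrite /= mxE.
move=> _ [d d0 <-].
have km0 : 0 <= kappa_max (rescale d (ker A)).
  by apply: (big_ind (fun x => 0 <= x)) => // [x y x0 y0|k _]; rewrite ?le_max ?x0 //;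
     apply: (big_ind (fun x => 0 <= x)) => // [x y x0 y0|l _]; rewrite ?le_max ?x0 //;
     apply: (big_ind (fun x => 0 <= x)) => // [x y x0 y0|C _]; rewrite ?le_max ?x0 // divr_ge0.
rewrite -(ger0_norm km0) -sqrtr_sqr ler_wsqrtr // ler_pdivrMr //.
exact: kappa_max_rescale.
Qed.

End Elementary.

(** * The search from one source *)

(** Rows and columns are numbered by natural numbers here, as in the memory of the
    program. *)
Section Search.
Variables (F : fieldType) (m n : nat) (T : nat -> nat -> F) (B : nat -> nat).

Definition reduced :=
  (forall r, r < m -> B r < n)%N /\
  (forall q r, (q < m)%N -> (r < m)%N -> T q (B r) = (q == r)%:R).

(** The unions of classes of linked indices. *)
Definition row_closed (D : nat -> bool) :=
  forall r u v, (r < m)%N -> (u < n)%N -> (v < n)%N ->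
    T r u != 0 -> T r v != 0 -> D u = D v.

(** The equivalence generated by being nonzero in a common row.  Quantifying over
    the closed sets replaces an induction along a path by the choice of one set;
    symmetry holds because complements of closed sets are closed. *)
Definition linked i j := forall D, row_closed D -> D i -> D j.

Lemma linked_trans i j k : linked i j -> linked j k -> linked i k.
Proof. by move=> ij jk D hD /(ij D hD)/(jk D hD). Qed.

Lemma linked_sym i j : linked i j -> linked j i.
Proof.
move=> ij D hD Dj; apply: contraT => nDi.
have hC : row_closed (fun k => ~~ D k) by move=> *; congr (~~ _); apply: hD; eauto.
by have := ij _ hC nDi; rewrite Dj.
Qed.

Lemma linked_row r u v : (r < m)%N -> (u < n)%N -> (v < n)%N ->
  T r u != 0 -> T r v != 0 -> linked u v.
Proof. by move=> rm un vn ru rv D hD; rewrite (hD r u v). Qed.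

Definition indep_cols (e : nat -> nat) :=
  forall y : nat -> F,
    (forall q, (q < m)%N -> \sum_(r < m) y r * T q (e r) = 0) ->
    forall r, (r < m)%N -> y r = 0.

(** The data of the index [v] reached from the source [i]: the columns
    [e 0 .. e (m - 1)] form a basis, slot [m] holds [v] itself, and [x] are the
    coefficients of the relation between these [m + 1] columns.  [Q] is the set of
    the used rows and [Rc] the set of the reached indices.  Only the slots of used
    rows have been exchanged ([node_unmarked]), and they hold reached indices
    ([node_marked]), so that an unreached index is at most in its original slot.
    The source sits in the slot of a used row or is [v] ([node_source]), so that
    no later exchange touches it. *)
Record node (Q Rc : nat -> bool) (i v : nat) (e : nat -> nat) (x : nat -> F) := {
  node_lt : forall r, (r < m)%N -> (e r < n)%N;
  node_last : e m = v;
  node_indep : indep_cols e;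
  node_rel : forall q, (q < m)%N -> \sum_(r < m.+1) x r * T q (e r) = 0;
  node_neq0 : x m != 0;
  node_unmarked : forall r, (r < m)%N -> ~~ Q r -> e r = B r;
  node_marked : forall r, (r < m)%N -> Q r -> Rc (e r);
  node_source : i = v \/ exists r, [/\ (r < m)%N, Q r, e r = i & x r != 0];
  node_frontier : forall r, (r < m)%N -> ~~ Q r -> x r != 0 -> linked i (B r);
  node_fresh : v <> i -> forall r, (r < m)%N -> e r <> v;
  node_linked : linked i v
}.

(** No unused row can be used next. *)
Definition stuck (Q Rc : nat -> bool) (X : nat -> nat -> F) :=
  forall r, (r < m)%N -> ~~ Q r -> forall v, (v < n)%N -> Rc v -> X v r = 0.

(** An unused row that no relation of a reached index involves is zero on all the
    reached indices ([search_unmarked]): cancellations do not hide a link.  This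
    is what makes a stuck search complete. *)
Record searching (i : nat) (Q Rc : nat -> bool) E X := {
  search_node : forall v, (v < n)%N -> Rc v -> node Q Rc i v (E v) (X v);
  search_source : Rc i;
  search_marked : forall r v, (r < m)%N -> Q r -> (v < n)%N -> T r v != 0 -> Rc v;
  search_unmarked : forall r, (r < m)%N -> ~~ Q r ->
    (forall v, (v < n)%N -> Rc v -> X v r = 0) ->
    forall v, (v < n)%N -> Rc v -> T r v = 0
}.

Hypothesis redT : reduced.
Let hB r : (r < m)%N -> (B r < n)%N. Proof. exact: redT.1. Qed.
Let hT q r : (q < m)%N -> (r < m)%N -> T q (B r) = (q == r)%:R. Proof. exact: redT.2. Qed.

Lemma basis_indep : indep_cols B.
Proof.
move=> y hy r rm; rewrite -(hy r rm) (bigD1 (Ordinal rm)) //= hT // eqxx mulr1.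
rewrite big1 ?addr0 // => q; rewrite -val_eqE /= => qr.
by rewrite hT // eq_sym (negbTE qr) mulr0.
Qed.

Lemma basis_expand (f : nat -> F) q : (q < m)%N -> \sum_(r < m) f r * T q (B r) = f q.
Proof.
move=> qm; rewrite (bigD1 (Ordinal qm)) //= hT // eqxx mulr1.
rewrite big1 ?addr0 // => r; rewrite -val_eqE /= => qr.
by rewrite hT // eq_sym (negbTE qr) mulr0.
Qed.

(** The relation of the source with the initial basis has the entries of its
    column in the reduced matrix as coefficients.  If the source is in the basis,
    this relation is trivial and gives no circuit, but the exchange steps that
    start from it are valid. *)
Lemma search_start i E X Q Rc : (i < n)%N ->
  (forall r, (r < m)%N -> ~~ Q r) -> (forall v, (v < n)%N -> Rc v = (v == i)) ->
  (forall r, (r < m)%N -> E i r = B r /\ X i r = - T r i) ->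
  E i m = i -> X i m = 1 -> searching i Q Rc E X.
Proof.
move=> lti hQ hR hE hEm hXm; split=> [v vn||r v rm|r rm nQ hX v vn].
- rewrite hR // => /eqP->; split=> //.
  + by move=> r rm; rewrite (hE r rm).1; apply: hB.
  + move=> y hy; apply: basis_indep => q qm; rewrite -[RHS](hy q qm).
    by apply: eq_bigr => r _; rewrite (hE r (ltn_ord r)).1.
  + move=> q qm; rewrite big_ord_recr /= hEm hXm mul1r.
    rewrite -[X in _ + X]opprK -(basis_expand (fun r => - T r i) qm).
    rewrite -sumrB big1 // => r _; have [-> ->] := hE r (ltn_ord r).
    by rewrite subrr.
  + by rewrite hXm oner_neq0.
  + by move=> r rm _; case: (hE r rm).
  + by move=> r rm hr; have := hQ r rm; rewrite hr.
  + by left.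
  + move=> r rm _; rewrite (hE r rm).2 oppr_eq0 => rv.
    by apply: (linked_row rm) => //; rewrite ?hB // hT // eqxx oner_neq0.
- by rewrite hR.
- by move=> hr; have := hQ r rm; rewrite hr.
- by rewrite hR // => /eqP->; apply/eqP; rewrite -oppr_eq0 -(hE r rm).2 hX ?hR.
Qed.

(** In the rows where the column of [v] is nonzero, the basis of [p] still has its
    original unit vectors, so that the entries of this column in the reduced
    matrix are also its coordinates in the basis of [p].  Subtracting the multiple
    of them that cancels slot [b] from the relation of [p] gives the relation of
    [v]. *)
Lemma node_step i (Q Rc Q' Rc' : nat -> bool) b p v e x e' x' :
  node Q Rc i p e x ->
  (forall r u, (r < m)%N -> Q r -> (u < n)%N -> T r u != 0 -> Rc u) ->
  (b < m)%N -> ~~ Q b -> (p < n)%N -> Rc p -> x b != 0 ->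
  (v < n)%N -> ~~ Rc v -> T b v != 0 ->
  (forall r, (r < m)%N -> Q' r = Q r || (r == b)) ->
  (forall u, (u < n)%N -> Rc u -> Rc' u) ->
  (forall r, (r < m)%N -> e' r = if r == b then p else e r) -> e' m = v ->
  (forall r, (r < m)%N -> x' r = if r == b then x m else x r - x b / T b v * T r v) ->
  x' m = x b / T b v ->
  node Q' Rc' i v e' x'.
Proof.
move=> [lt_e lst ind rel x0 unm mrk src frn frs lnk] cl bm nQb pn Rp xb vn nRv Tbv.
move=> hQ' hR' he' he'm hx' hx'm.
have c0 : x b / T b v != 0 by rewrite mulf_neq0 // invr_eq0.
have Tv0 r : (r < m)%N -> Q r -> T r v = 0.
  by move=> rm Qr; apply: contraNeq nRv; apply: cl.
have lbv : linked (B b) v.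
  by apply: (linked_row bm) => //; rewrite ?hB // hT // eqxx oner_neq0.
have liv : linked i v by apply: linked_trans lbv; apply: frn.
have expand q : (q < m)%N -> \sum_(r < m) T r v * T q (e r) = T q v.
  move=> qm; rewrite -(basis_expand (fun r => T r v) qm); apply: eq_bigr => r _.
  case: (boolP (Q r)) => Qr; first by rewrite Tv0 ?mul0r.
  by rewrite unm.
pose ob := Ordinal bm.
split=> //.
- by move=> r rm; rewrite he' //; case: ifP => // _; apply: lt_e.
- move=> y hy.
  (* the coordinates of the same combination in the basis of [p] *)
  pose z r := if r == b then - (y b * x b / x m) else y r - y b * x r / x m.
  have hy' q : (q < m)%N -> \sum_(r < m) z r * T q (e r) = 0.
    move=> qm; have := rel q qm; rewrite big_ord_recr /= lst => relq.
    have := hy q qm; rewrite (bigD1 ob) //= he' // eqxx => hyq.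
    have {}relq : T q p = - (x m)^-1 * \sum_(r < m) x r * T q (e r).
      have -> : \sum_(r < m) x r * T q (e r) = - (x m * T q p).
        by apply/eqP; rewrite -addr_eq0 relq.
      by field.
    rewrite -[RHS]hyq relq (bigD1 ob) //= {1}/z eqxx [in RHS](bigD1 ob) //=.
    have -> : \sum_(r < m | r != ob) z r * T q (e r) =
        \sum_(r < m | r != ob) y r * T q (e' r)
        - y b / x m * \sum_(r < m | r != ob) x r * T q (e r).
      rewrite mulr_sumr -sumrB; apply: eq_bigr => r; rewrite -val_eqE /= => rb.
      by rewrite he' // /z (negbTE rb); field.
    by move: (\sum_(r < m | _) _) (\sum_(r < m | _) _) => S1 S2; field.
  move=> r rm; have yb : y b = 0.
    have := ind _ hy' b bm; rewrite /z eqxx => /eqP.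
    by rewrite oppr_eq0 !mulf_eq0 invr_eq0 (negbTE xb) (negbTE x0) !orbF => /eqP.
  have [->//|rb] := eqVneq r b.
  by have := ind _ hy' r rm; rewrite /z (negbTE rb) yb !mul0r subr0.
- move=> q qm; rewrite big_ord_recr /= he'm hx'm (bigD1 ob) //=.
  rewrite he' // hx' // eqxx.
  have := rel q qm; rewrite big_ord_recr /= lst (bigD1 ob) //= => relq.
  have := expand q qm; rewrite (bigD1 ob) //= => expq.
  have -> : \sum_(r < m | r != ob) x' r * T q (e' r) =
      \sum_(r < m | r != ob) x r * T q (e r)
      - x b / T b v * \sum_(r < m | r != ob) T r v * T q (e r).
    rewrite mulr_sumr -sumrB; apply: eq_bigr => r; rewrite -val_eqE /= => rb.
    by rewrite he' // hx' // (negbTE rb); ring.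
  move: relq expq; move: (\sum_(r < m | _) _) => S1.
  move: (\sum_(r < m | _) _) => S2 h1 <-.
  have -> : S1 = - (x m * T q p) - x b * T q (e b).
    by apply/eqP; rewrite -subr_eq0 -h1; apply/eqP; ring.
  by field.
- by rewrite hx'm.
- move=> r rm; rewrite hQ' // negb_or => /andP[nQ rb].
  by rewrite he' // (negbTE rb) unm.
- move=> r rm; rewrite hQ' // he' //; case: eqP => [_ _|rb]; first exact: hR'.
  by rewrite orbF => Qr; apply: hR'; [apply: lt_e|apply: mrk].
- right; case: src => [->|[r [rm Qr er xr]]].
    by exists b; rewrite hQ' ?eqxx ?orbT // he' // hx' // eqxx.
  have rb : r != b by apply: contraNneq nQb => <-.
  exists r; rewrite hQ' // Qr he' // hx' // (negbTE rb); split=> //.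
  by rewrite (Tv0 r) // mulr0 subr0.
- move=> r rm; rewrite hQ' // negb_or => /andP[nQ rb].
  rewrite hx' // (negbTE rb) => xr; have [Trv|Trv] := eqVneq (T r v) 0.
    by apply: frn => //; move: xr; rewrite Trv mulr0 subr0.
  apply: linked_trans liv _; apply: (linked_row rm) => //; first exact: hB.
  by rewrite hT // eqxx oner_neq0.
- move=> vi r rm; rewrite he' //; case: eqP => [_ pv|/eqP rb erv].
    by move: nRv; rewrite -pv Rp.
  case: (boolP (Q r)) => Qr; first by move: nRv; rewrite -erv mrk.
  by move: Tbv; rewrite -erv unm // hT // [b == r]eq_sym (negbTE rb) eqxx.
Qed.

(** The coefficients of the new nodes in an unused row [r] are those of [p] minus a
    nonzero multiple of [T r v]; where both relations vanish, so does [T r v].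
    This preserves [search_unmarked]. *)
Lemma search_step i (Q Rc Q' Rc' : nat -> bool) b p E X E' X' :
  searching i Q Rc E X ->
  (b < m)%N -> ~~ Q b -> (p < n)%N -> Rc p -> X p b != 0 ->
  (forall r, (r < m)%N -> Q' r = Q r || (r == b)) ->
  (forall v, (v < n)%N -> Rc' v = Rc v || (T b v != 0)) ->
  (forall v, (v < n)%N -> Rc v -> E' v = E v /\ X' v = X v) ->
  (forall v, (v < n)%N -> ~~ Rc v -> T b v != 0 ->
     [/\ forall r, (r < m)%N -> E' v r = (if r == b then p else E p r), E' v m = v,
         forall r, (r < m)%N ->
           X' v r = if r == b then X p m else X p r - X p b / T b v * T r v &
         X' v m = X p b / T b v]) ->
  Rc' i -> searching i Q' Rc' E' X'.
Proof.
move=> [nod srcR cl unm] bm nQb pn Rp xb hQ' hR' old new Ri.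
have hRR u : (u < n)%N -> Rc u -> Rc' u by move=> un Ru; rewrite hR' // Ru.
split=> //.
- move=> v vn; rewrite hR' //; case: (boolP (Rc v)) => [Rv _|nRv /= Tv]; last first.
    have [h1 h2 h3 h4] := new v vn nRv Tv.
    by apply: (node_step (nod p pn Rp) cl bm nQb pn Rp xb vn nRv Tv).
  have [-> ->] := old v vn Rv; have [] := nod v vn Rv.
  move=> lt_e lst ind rel x0 um mrk src frn frs lnk; split=> //.
  + by move=> r rm; rewrite hQ' // negb_or => /andP[nQ _]; apply: um.
  + move=> r rm; rewrite hQ' //; case: (boolP (Q r)) => [Qr _|nQ /= /eqP rb].
      by apply: hRR; [apply: lt_e|apply: mrk].
    by rewrite um // hR' ?hB // rb hT // eqxx oner_neq0 orbT.
  + case: src => [->|[r [rm Qr er xr]]]; [by left|right].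
    by exists r; rewrite hQ' // Qr.
  + by move=> r rm; rewrite hQ' // negb_or => /andP[nQ _]; apply: frn.
- move=> r v rm + vn Tr; rewrite hQ' // hR' //.
  case: (boolP (Q r)) => [Qr _|nQ /= /eqP rb]; first by rewrite (cl r).
  by rewrite -rb Tr orbT.
- move=> r rm; rewrite hQ' // negb_or => /andP[nQ rb] hX.
  have hXo v : (v < n)%N -> Rc v -> X v r = 0.
    by move=> vn Rv; have [_ <-] := old v vn Rv; apply: hX; rewrite ?hRR.
  move=> v vn; rewrite hR' //; case: (boolP (Rc v)) => [Rv _|nRv /= Tv].
    exact: unm.
  have [_ _ h3 _] := new v vn nRv Tv.
  have := hX v vn; rewrite hR' // Tv orbT => /(_ isT).
  rewrite h3 // (negbTE rb) (hXo p) // sub0r => /eqP.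
  by rewrite oppr_eq0 !mulf_eq0 invr_eq0 (negbTE xb) (negbTE Tv) => /eqP.
Qed.

(** Each row is nonzero on reached indices only, if it was used, and on unreached
    indices only, if it was not; so the set of the reached indices is closed. *)
Lemma search_end i Q Rc E X : searching i Q Rc E X -> stuck Q Rc X ->
  forall v, (v < n)%N -> Rc v <-> linked i v.
Proof.
move=> [nod src cl unm] st v vn; split=> [Rv|]; first by case: (nod v vn Rv).
apply=> // r u w rm un wn Tu Tw; case: (boolP (Q r)) => Qr.
  by rewrite (cl r u) // (cl r w).
have h := unm r rm Qr (st r rm Qr).
by apply/idP/idP => /h; [move/(_ un) => e; rewrite e eqxx in Tu
                        |move/(_ wn) => e; rewrite e eqxx in Tw].
Qed.

End Search.

(** * Circuits from the search *)

Section NodeCircuit.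
Variables (R : realType) (m n : nat).

Definition mat (T : nat -> nat -> R) : 'M[R]_(m, n) := \matrix_(q < m, c < n) T q c.

Definition sparse k (e : nat -> nat) (x : nat -> R) : 'cV[R]_n :=
  \col_(c < n) \sum_(r < k) x r *+ (e r == c).

Lemma mat_sparse T k e x (q : 'I_m) : (forall r, (r < k)%N -> (e r < n)%N) ->
  (mat T *m sparse k e x) q 0 = \sum_(r < k) x r * T q (e r).
Proof.
move=> he; rewrite mxE.
under eq_bigr => c _ do rewrite !mxE mulr_sumr.
rewrite exchange_big; apply: eq_bigr => r _ /=.
rewrite (bigD1 (Ordinal (he r (ltn_ord r)))) //= eqxx mulr1n mulrC.
rewrite big1 ?addr0 // => c; rewrite -val_eqE /= eq_sym => h.
by rewrite (negbTE h) mulr0n mulr0.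
Qed.

Lemma sparse_at k (e : nat -> nat) x r (c : 'I_n) :
  (forall r s, (r < k)%N -> (s < k)%N -> e r = e s -> r = s) ->
  (r < k)%N -> e r = c -> sparse k e x c 0 = x r.
Proof.
move=> inj rk er; rewrite mxE (bigD1 (Ordinal rk)) //= er eqxx mulr1n.
rewrite big1 ?addr0 // => s; rewrite -val_eqE /= => h.
case: eqP => // es; case/eqP: h; by apply: inj => //; rewrite es er.
Qed.

Lemma sparse_out k (e : nat -> nat) x (c : 'I_n) :
  (forall r, (r < k)%N -> e r <> c) -> sparse k e x c 0 = 0.
Proof.
by move=> h; rewrite mxE big1 // => r _; case: eqP => // /h; case.
Qed.

Lemma indep_inj (T : nat -> nat -> R) e : indep_cols m T e ->
  forall r s, (r < m)%N -> (s < m)%N -> e r = e s -> r = s.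
Proof.
move=> ind r s rm sm ers; apply/eqP; apply: contraT => rs.
suff : (r == r)%:R - (r == s)%:R = 0 :> R.
  by rewrite eqxx (negbTE rs) subr0 => /eqP; rewrite oner_eq0.
apply: (ind (fun k => (k == r)%:R - (k == s)%:R)) => // q qm.
under eq_bigr => k _ do rewrite mulrBl.
rewrite sumrB (bigD1 (Ordinal rm)) //= eqxx mul1r ers.
rewrite [X in _ - X](bigD1 (Ordinal sm)) //= eqxx mul1r !big1 ?subrr // => k.
  by rewrite -val_eqE /= => /negbTE->; rewrite mul0r.
by rewrite -val_eqE /= => /negbTE->; rewrite mul0r.
Qed.

Variables (T : nat -> nat -> R) (B : nat -> nat).
Variables (Q Rc : nat -> bool) (i v : nat) (e : nat -> nat) (x : nat -> R).
Hypotheses (nd : node m n T B Q Rc i v e x) (vi : v <> i) (vn : (v < n)%N).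

Lemma node_slot_lt r : (r < m.+1)%N -> (e r < n)%N.
Proof.
by rewrite ltnS leq_eqVlt => /predU1P[->|/(node_lt nd)//]; rewrite (node_last nd).
Qed.

Lemma node_inj r s : (r < m.+1)%N -> (s < m.+1)%N -> e r = e s -> r = s.
Proof.
rewrite ltnS leq_eqVlt => /predU1P[->|rm]; rewrite ltnS leq_eqVlt => /predU1P[->|sm] //.
- by rewrite (node_last nd) => h; case: (node_fresh nd vi sm).
- by rewrite (node_last nd) => h; case: (node_fresh nd vi rm).
- exact: (indep_inj (node_indep nd)).
Qed.

Lemma node_supp (c : 'I_n) : reflect
  (exists r, [/\ (r < m.+1)%N, e r = c & x r != 0]) (c \in supp (sparse m.+1 e x)).
Proof.
apply: (iffP idP) => [|[r [rm er xr]]].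
  apply: contraTP => h; rewrite in_supp negbK.
  rewrite mxE big1 // => r _; case: eqP => [er|//]; apply/eqP; apply: contraT => xr.
  by case: h; exists r; rewrite ltn_ord.
by rewrite in_supp (sparse_at x node_inj rm er).
Qed.

(** The relation carried by a node is the only one among its columns, up to
    scaling, as those other than [v] itself are independent. *)
Lemma node_elementary : elementary (ker (mat T)) (sparse m.+1 e x).
Proof.
set g := sparse _ _ _.
have gv : g (Ordinal vn) 0 = x m.
  by apply: (sparse_at x node_inj) => //; rewrite (node_last nd).
split.
- apply/matrixP => q j; rewrite ord1 mat_sparse; last exact: node_slot_lt.
  by rewrite mxE (node_rel nd).
- by rewrite supp_neq0; apply/finset.set0Pn; exists (Ordinal vn); rewrite in_supp gv (node_neq0 nd).
move=> h kh hg; exists (h (Ordinal vn) 0 / x m); set a := _ / _.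
apply/eqP; rewrite -subr_eq0; apply/eqP.
set d := h - a *: g.
have kg : ker (mat T) g.
  apply/matrixP => q j; rewrite ord1 mat_sparse; last exact: node_slot_lt.
  by rewrite mxE (node_rel nd).
have kd : ker (mat T) d by apply: ker_lin.
pose y r := if insub (e r) is Some c then d c 0 else 0.
have dE c : d c 0 = h c 0 - a * g c 0 by rewrite /d !mxE.
have dv : d (Ordinal vn) 0 = 0 by rewrite dE gv divfK ?subrr ?(node_neq0 nd).
have dout (c : 'I_n) : (forall r, (r < m)%N -> e r <> c) -> d c 0 = 0.
  move=> hc; have [->//|cv] := eqVneq c (Ordinal vn).
  have gc : g c 0 = 0.
    apply: sparse_out => r; rewrite ltnS leq_eqVlt => /predU1P[->|]; last exact: hc.
    by rewrite (node_last nd) => vc; case/eqP: cv; apply: val_inj.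
  rewrite dE gc mulr0 subr0; apply/eqP; apply: contraT; rewrite -in_supp.
  by move/(fintype.subsetP hg); rewrite in_supp gc eqxx.
have yE r (c : 'I_n) : e r = c -> y r = d c 0 by rewrite /y => ->; rewrite valK.
have ds : d = sparse m e y.
  apply/matrixP => c j; rewrite ord1.
  have [[r [rm er]]|nr] := pselect (exists r, (r < m)%N /\ e r = c).
    by rewrite (sparse_at y (indep_inj (node_indep nd)) rm er) (yE r c).
  rewrite dout ?sparse_out // => r rm er; apply: nr; exists r; split=> //.
have y0 r : (r < m)%N -> y r = 0.
  apply: (node_indep nd) => q qm.
  have kd0 : mat T *m d = 0 := kd.
  rewrite -(mat_sparse T y (Ordinal qm)); last exact: (node_lt nd).
  by rewrite -ds kd0 mxE.
rewrite ds; apply/matrixP => c j; rewrite !mxE big1 // => r _.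
by rewrite y0 // mul0rn.
Qed.

Lemma node_mem_target : Ordinal vn \in supp (sparse m.+1 e x).
Proof. by apply/node_supp; exists m; rewrite (node_last nd) (node_neq0 nd) ltnS. Qed.

Lemma node_mem_source (ltin : (i < n)%N) : Ordinal ltin \in supp (sparse m.+1 e x).
Proof.
case: (node_source nd) => [iv|[r [rm _ er xr]]]; first by case: vi.
by apply/node_supp; exists r; rewrite er xr ltnS ltnW.
Qed.

End NodeCircuit.

(** * Gaussian elimination *)

Section Gauss.
Variables (R : realType) (m n : nat).
Implicit Types T : nat -> nat -> R.

(** One step of Gauss-Jordan elimination at row [r] and column [b]. *)
Definition gauss_row T r b : nat -> nat -> R :=
  fun q c => if q == r then T r c / T r b else T q c - T q b * (T r c / T r b).

Lemma gauss_row_eqmx T r b : (r < m)%N -> T r b != 0 ->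
  (mat m n (gauss_row T r b) :=: mat m n T)%MS.
Proof.
move=> rm Trb; set M := mat _ _ T; set M' := mat _ _ _; pose o := Ordinal rm.
have Mo : row o M' = (T r b)^-1 *: row o M.
  by apply/rowP => c; rewrite !mxE /gauss_row eqxx mulrC.
have Mq q : q != o -> row q M' = row q M - T q b *: row o M'.
  move=> qo; apply/rowP => c; rewrite !mxE /gauss_row /= eqxx ifN //.
have sub : (M' <= M)%MS.
  have so : (row o M' <= M)%MS by rewrite Mo scalemx_sub ?row_sub.
  apply/row_subP => q; have [->//|qo] := eqVneq q o.
  by rewrite Mq // addmx_sub ?row_sub // eqmx_opp scalemx_sub.
have sub' : (M <= M')%MS.
  apply/row_subP => q; have [->|qo] := eqVneq q o.
    have -> : row o M = T r b *: row o M' by rewrite Mo scalerA divff // scale1r.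
    by rewrite scalemx_sub ?row_sub.
  have -> : row q M = row q M' + T q b *: row o M' by rewrite Mq // subrK.
  by rewrite addmx_sub ?row_sub // scalemx_sub ?row_sub.
by apply/eqmxP; rewrite sub sub'.
Qed.

Lemma eqmx_ker p (M N : 'M[R]_(p, n)) : (M :=: N)%MS -> ker M = ker N.
Proof.
move=> e; apply/seteqP; split=> g /= h; rewrite /ker /=.
  have /submxP[D ->] : (N <= M)%MS by rewrite e.
  by rewrite -mulmxA h mulmx0.
have /submxP[D ->] : (M <= N)%MS by rewrite e.
by rewrite -mulmxA h mulmx0.
Qed.

(** Row-equivalence to the input keeps the rows independent, so no row exchanges
    are needed to find a pivot. *)
Lemma row_free_pivot T r : row_free (mat m n T) -> (r < m)%N ->
  exists2 b, (b < n)%N & T r b != 0.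
Proof.
move=> fr rm; apply: contrapT => h.
have : row (Ordinal rm) (mat m n T) = 0.
  apply/rowP => c; rewrite !mxE; apply/eqP; apply: contraT => Tc.
  by case: h; exists c.
rewrite rowE -(mul0mx _ (mat m n T)) => /(row_free_inj fr) /matrixP/(_ 0 (Ordinal rm)).
by rewrite !mxE !eqxx => /eqP; rewrite oner_eq0.
Qed.

End Gauss.

(** * The program *)

Local Notation "p ;; q" := (Then p q) (at level 90, right associativity).
Local Notation idx0 := (NConst 0).

(** Arrays of natural numbers.  The label [i + 1] also marks the indices reached
    from the source [i], and likewise for the rows in [markA]: as the sources come
    in increasing order, older marks are smaller and need no reset. *)
Local Notation labelA := 1%N.
Local Notation countA := 2%N.
Local Notation sizeA := 3%N.
Local Notation listA := 4%N.
Local Notation basisA := 6%N.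
Local Notation markA := 7%N.
Local Notation slotA := 8%N.

(** Variables, each in cell [(0, 0)] of its own array, and the expressions that
    read them. *)
Local Notation vr := 10%N.
Local Notation vc := 11%N.
Local Notation vq := 12%N.
Local Notation vi := 13%N.
Local Notation vround := 14%N.
Local Notation vb := 15%N.
Local Notation vu := 16%N.
Local Notation vrow := 17%N.
Local Notation vparent := 18%N.
Local Notation vs := 19%N.
Local Notation vt := 20%N.
Local Notation get_count := (var countA).
Local Notation get_r := (var vr).
Local Notation get_c := (var vc).
Local Notation get_q := (var vq).
Local Notation get_i := (var vi).
Local Notation get_b := (var vb).
Local Notation get_u := (var vu).
Local Notation get_row := (var vrow).
Local Notation get_parent := (var vparent).
Local Notation get_s := (var vs).
Local Notation get_t := (var vt).

(** Arrays of reals.  For a reached index [u], the row [u] of [slotA] and that of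
    [coefA] are the basis and the coefficients of its node. *)
Local Notation matA := 0%N.
Local Notation tableA := 1%N.
Local Notation coefA := 2%N.
Local Notation tmpA := 3%N.

Definition tmp := RRead tmpA idx0 idx0.
Definition nonzero e := BNot (REq e (RConst 0)).
Definition nsucc e := NAdd e (NConst 1).
Definition last_slot := dim_expr Rows.

(** Any nonzero entry can serve as the pivot, so later ones may overwrite the
    choice. *)
Definition gauss_select :=
  For vc Cols (When (nonzero (RRead matA get_r get_c)) (SetN basisA idx0 get_r get_c)).

Definition pivot_col := NRead basisA idx0 get_r.

Definition gauss_scale_loop :=
  For vc Cols (SetR matA get_r get_c (RDiv (RRead matA get_r get_c) tmp)).

Definition gauss_scale :=
  SetR tmpA idx0 idx0 (RRead matA get_r pivot_col) ;; gauss_scale_loop.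

Definition gauss_sub_loop :=
  For vc Cols (SetR matA get_q get_c
    (RSub (RRead matA get_q get_c) (RMul tmp (RRead matA get_r get_c)))).

Definition gauss_sub :=
  SetR tmpA idx0 idx0 (RRead matA get_q pivot_col) ;; gauss_sub_loop.

Definition gauss_elim := For vq Rows (When (BNot (NEq get_q get_r)) gauss_sub).

Definition gauss := For vr Rows (gauss_select ;; gauss_scale ;; gauss_elim).

Definition reached u := NEq (NRead labelA idx0 u) (nsucc get_i).
Definition marked r := NEq (NRead markA idx0 r) (nsucc get_i).

Definition start_loop :=
  For vs Rows (SetN slotA get_i get_s (NRead basisA idx0 get_s) ;;
               SetR coefA get_i get_s (RSub (RConst 0) (RRead matA get_s get_i))).

Definition start :=
  SetN labelA idx0 get_i (nsucc get_i) ;;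
  start_loop ;;
  SetN slotA get_i last_slot get_i ;;
  SetR coefA get_i last_slot (RConst 1).

Definition find_pivot_row :=
  For vu Cols
    (When (BAnd (reached get_u) (BAnd (BNot (marked get_b)) (nonzero (RRead coefA get_u get_b))))
       (SetN vrow idx0 idx0 get_b ;; SetN vparent idx0 idx0 get_u)).

Definition find_pivot_loop := For vb Rows find_pivot_row.

(** The value [m] of the variable [vrow] means that no row was found. *)
Definition find_pivot := SetN vrow idx0 idx0 last_slot ;; find_pivot_loop.

Definition pivot_ratio :=
  RDiv (RRead coefA get_parent get_row) (RRead matA get_row get_u).

(** Copying slot [vrow] along saves a test; it gets its value afterwards. *)
Definition create_loop :=
  For vs Rows (SetN slotA get_u get_s (NRead slotA get_parent get_s) ;;
               SetR coefA get_u get_s (RSub (RRead coefA get_parent get_s)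
                 (RMul pivot_ratio (RRead matA get_s get_u)))).

Definition create :=
  create_loop ;;
  SetN slotA get_u get_row get_parent ;;
  SetR coefA get_u get_row (RRead coefA get_parent last_slot) ;;
  SetN slotA get_u last_slot get_u ;;
  SetR coefA get_u last_slot pivot_ratio ;;
  SetN labelA idx0 get_u (nsucc get_i).

Definition expand_loop :=
  For vu Cols
    (When (BAnd (BNot (reached get_u)) (nonzero (RRead matA get_row get_u))) create).

Definition expand :=
  When (NLt get_row last_slot) (SetN markA idx0 get_row (nsucc get_i) ;; expand_loop).

Definition rounds := For vround Rows (find_pivot ;; expand).

Definition search := start ;; rounds.

(** Only a zero denominator has to be excluded: a zero numerator gives the ratio
    zero, which leaves the table as it is, its values being nonnegative. *)
Definition update_entry :=
  SetR tmpA idx0 idx0 (RDiv (RRead coefA get_u get_t) (RRead coefA get_u get_s)) ;;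
  When (RLt tmp (RConst 0)) (SetR tmpA idx0 idx0 (RSub (RConst 0) tmp)) ;;
  When (RLt (RRead tableA (NRead slotA get_u get_s) (NRead slotA get_u get_t)) tmp)
    (SetR tableA (NRead slotA get_u get_s) (NRead slotA get_u get_t) tmp).

Definition list_size := NRead sizeA idx0 get_count.

Definition entries := For vt Slots update_entry.

Definition emit_entry :=
  When (nonzero (RRead coefA get_u get_s))
    (SetN listA get_count list_size (NRead slotA get_u get_s) ;;
     SetN sizeA idx0 get_count (nsucc list_size) ;;
     entries).

Definition emit_loop := For vs Slots emit_entry.

Definition emit :=
  SetN sizeA idx0 get_count idx0 ;;
  emit_loop ;;
  SetN countA idx0 idx0 (nsucc get_count).

(** All circuits of one source are written after its search has ended, which
    keeps the quadratic cost of a table update out of the rounds. *)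
Definition emit_all :=
  For vu Cols (When (BAnd (reached get_u) (BNot (NEq get_u get_i))) emit).

Definition main_loop := For vi Cols (search ;; emit_all).

Definition find_circuits := gauss ;; main_loop.

Lemma find_circuits_wf : wf find_circuits. Proof. by []. Qed.
Lemma find_circuits_keeps_dims : 0%N \notin writesN find_circuits. Proof. by []. Qed.
Lemma find_circuits_deg : degC find_circuits = 2 /\ degR find_circuits = 2.
Proof. by []. Qed.

(** * Correctness of the elimination *)

Section Correct.
Variables (R : realType) (m n : nat).
Implicit Types s : state R.

Lemma dims_frame s s' : has_dims m n s -> nmem s' 0 = nmem s 0 -> has_dims m n s'.
Proof. by rewrite /has_dims => -[h1 h2] ->. Qed.

Lemma gauss_select_spec s r : has_dims m n s -> nmem s vr 0 0 = r ->
  let s' := run gauss_select s in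
  (exists2 c, (c < n)%N & rmem s matA r c != 0) ->
  [/\ (nmem s' basisA 0 r < n)%N, rmem s matA r (nmem s' basisA 0 r) != 0 &
      forall q, q != r -> nmem s' basisA 0 q = nmem s basisA 0 q].
Proof.
move=> hd rE s' [c0 c0n hc0].
suff [h1 h2] : ((exists2 c, (c < n)%N & rmem s matA r c != 0) ->
     (nmem s' basisA 0 r < n)%N && (rmem s matA r (nmem s' basisA 0 r) != 0)) /\
   (forall q, q != r -> nmem s' basisA 0 q = nmem s basisA 0 q).
  by have /andP[] : (nmem s' basisA 0 r < n)%N && (rmem s matA r (nmem s' basisA 0 r) != 0)
    by apply: h1; exists c0.
apply: (run_for (d := Cols) (Inv := fun k s' => ((exists2 c, (c < k)%N & rmem s matA r c != 0) ->
   (nmem s' basisA 0 r < n)%N && (rmem s matA r (nmem s' basisA 0 r) != 0)) /\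
   (forall q, q != r -> nmem s' basisA 0 q = nmem s basisA 0 q)) hd) => //.
  by split=> // -[].
move=> k t kn fN fR tk [I1 I2] /=.
rewrite /= tk (fN vr isT) (fR matA isT) [nmem _ vr 0 0]rE.
case: eqP => [Tk|Tk] /=.
  split=> // -[c]; rewrite ltnS leq_eqVlt => /predU1P[->|ck Tc]; first by rewrite Tk eqxx.
  by apply: I1; exists c.
split=> [_|q qr]; rewrite !updateE /=; last by rewrite (negbTE qr) I2.
by rewrite !eqxx kn; apply/eqP.
Qed.

Lemma gauss_scale_spec s r b : has_dims m n s ->
  nmem s vr 0 0 = r -> nmem s basisA 0 r = b ->
  forall q c, rmem (run gauss_scale s) matA q c =
    if (q == r) && (c < n)%N then rmem s matA r c / rmem s matA r b else rmem s matA q c.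
Proof.
move=> hd rE bE; pose s1 := run (SetR tmpA idx0 idx0 (RRead matA get_r pivot_col)) s.
rewrite -[run _ s]/(run gauss_scale_loop s1).
apply: (run_for (s := s1) (d := Cols) (Inv := fun k s' => forall q c,
  rmem s' matA q c = if (q == r) && (c < k)%N then rmem s matA r c / rmem s matA r b
                     else rmem s matA q c) hd) => //.
  by move=> q c; rewrite andbF.
move=> k t kn fN fR tk I q c /=.
rewrite tk (fN vr isT) (fR tmpA isT) /= rE bE !updateE /= I eqxx /= ltnn I.
case: (eqVneq q r) => [->|//] /=.
by rewrite ltnS [(c <= k)%N]leq_eqVlt; case: eqP => [->|].
Qed.

Lemma gauss_sub_spec s r b q : has_dims m n s ->
  nmem s vr 0 0 = r -> nmem s basisA 0 r = b -> nmem s vq 0 0 = q ->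
  q != r -> forall p c, rmem (run gauss_sub s) matA p c =
    if (p == q) && (c < n)%N then rmem s matA q c - rmem s matA q b * rmem s matA r c
    else rmem s matA p c.
Proof.
move=> hd rE bE qE qr; pose s1 := run (SetR tmpA idx0 idx0 (RRead matA get_q pivot_col)) s.
rewrite -[run _ s]/(run gauss_sub_loop s1).
apply: (run_for (s := s1) (d := Cols) (Inv := fun k s' => forall p c,
  rmem s' matA p c = if (p == q) && (c < k)%N
    then rmem s matA q c - rmem s matA q b * rmem s matA r c
                     else rmem s matA p c) hd) => //.
  by move=> p c; rewrite andbF.
move=> k t kn fN fR tk I p c /=.
rewrite tk (fN vq isT) (fN vr isT) (fR tmpA isT) /= rE bE qE !updateE /= !I eqxx /= ltnn.
rewrite [r == q]eq_sym (negbTE qr) /=.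
case: (eqVneq p q) => [->|//] /=.
by rewrite ltnS [(c <= k)%N]leq_eqVlt; case: eqP => [->|].
Qed.

Lemma gauss_elim_spec s r b : has_dims m n s ->
  nmem s vr 0 0 = r -> nmem s basisA 0 r = b ->
  (b < n)%N ->
  forall q c, rmem (run gauss_elim s) matA q c =
    if (q < m)%N && (q != r) && (c < n)%N
    then rmem s matA q c - rmem s matA q b * rmem s matA r c else rmem s matA q c.
Proof.
move=> hd r0 b0 bn.
apply: (run_for (d := Rows) (Inv := fun k s' => forall q c,
  rmem s' matA q c = if (q < k)%N && (q != r) && (c < n)%N
    then rmem s matA q c - rmem s matA q b * rmem s matA r c
                     else rmem s matA q c) hd) => //.
move=> k t km fN fR tk I q c.
have hdt : has_dims m n t by apply: dims_frame hd _; apply: fN.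
have rE : nmem t vr 0 0 = r by rewrite fN.
have bE : nmem t basisA 0 r = b by rewrite fN.
rewrite -[LHS]/(rmem (if nmem t vq 0 0 != nmem t vr 0 0 then run gauss_sub t else t)
  matA q c) tk rE ltnS; have [kr|kr] := eqVneq k r.
  rewrite I; congr (if _ then _ else _); rewrite -kr.
  by case: (ltngtP q k) => //; lia.
rewrite (gauss_sub_spec hdt rE bE tk kr).
have [->|qk] := eqVneq q k.
  by rewrite leqnn kr /= !I ltnn /= eqxx andbF /=.
rewrite andFb I; congr (if _ then _ else _).
by move: qk; case: (ltngtP q k).
Qed.

Lemma gauss_spec s : has_dims m n s -> row_free (mat m n (rmem s matA)) ->
  let s' := run gauss s in
  (mat m n (rmem s' matA) :=: mat m n (rmem s matA))%MS /\
  reduced m n (rmem s' matA) (nmem s' basisA 0).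
Proof.
move=> hd fr s'.
suff [h1 h2] : (mat m n (rmem s' matA) :=: mat m n (rmem s matA))%MS /\
  (forall r, (r < m)%N -> (nmem s' basisA 0 r < n)%N /\
     forall q, (q < m)%N -> rmem s' matA q (nmem s' basisA 0 r) = (q == r)%:R).
  by split=> //; split=> [r /h2[]//|q r qm /h2[_]]; apply.
apply: (run_for (d := Rows) (Inv := fun k s' =>
  (mat m n (rmem s' matA) :=: mat m n (rmem s matA))%MS /\
  (forall r, (r < k)%N -> (nmem s' basisA 0 r < n)%N /\
     forall q, (q < m)%N -> rmem s' matA q (nmem s' basisA 0 r) = (q == r)%:R)) hd) => //.
move=> k t km fN fR tk [I1 I2].
have hdt : has_dims m n t by apply: dims_frame hd _; apply: fN.
have frt : row_free (mat m n (rmem t matA)) by rewrite /row_free I1.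
have := gauss_select_spec hdt tk (row_free_pivot frt km).
set t1 := run gauss_select t => -[bn Tb oth].
have hd1 : has_dims m n t1 by apply: dims_frame hdt _; apply: run_frameN.
have k1 : nmem t1 vr 0 0 = k by rewrite run_frameN.
have T1 : rmem t1 matA = rmem t matA by rewrite run_frameR.
set b := nmem t1 basisA 0 k in bn Tb.
pose t2 := run gauss_scale t1.
have := gauss_scale_spec hd1 k1 (erefl b); rewrite T1 -/t2 => T2.
have hd2 : has_dims m n t2 by apply: dims_frame hd1 _; apply: run_frameN.
have k2 : nmem t2 vr 0 0 = k by rewrite run_frameN.
have b2 : nmem t2 basisA 0 k = b by rewrite run_frameN.
pose t3 := run gauss_elim t2.
have := gauss_elim_spec hd2 k2 b2 bn; rewrite -/t3 => T3.
have B3 : nmem t3 basisA = nmem t1 basisA by rewrite /t3 run_frameN // /t2 run_frameN.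
have T3E q c : (q < m)%N -> (c < n)%N ->
    rmem t3 matA q c = gauss_row (rmem t matA) k b q c.
  move=> qm cn; rewrite T3 qm cn andbT /gauss_row.
  by case: (eqVneq q k) => [->|qk] /=; rewrite !T2 eqxx cn //= (negbTE qk).
have M3 : mat m n (rmem t3 matA) = mat m n (gauss_row (rmem t matA) k b).
  by apply/matrixP => q c; rewrite !mxE T3E.
change (((mat m n (rmem t3 matA)) :=: mat m n (rmem s matA))%MS /\
  (forall r, (r < k.+1)%N -> (nmem t3 basisA 0 r < n)%N /\
     forall q, (q < m)%N -> rmem t3 matA q (nmem t3 basisA 0 r) = (q == r)%:R)).
split; first by rewrite M3; exact: (eqmx_trans (gauss_row_eqmx n km Tb) I1).
move=> r; rewrite ltnS leq_eqVlt B3 => /predU1P[->|rk].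
  split=> // q qm; rewrite T3E // /gauss_row divff // mulr1 subrr.
  by case: eqP.
rewrite oth; last by rewrite neq_ltn rk.
have [Bn BT] := I2 r rk; split=> // q qm; rewrite T3E // /gauss_row !BT //.
rewrite [k == r]eq_sym (ltn_eqF rk) mul0r mulr0 subr0.
by case: eqP => // ->; rewrite eq_sym (ltn_eqF rk).
Qed.

End Correct.

(** * Correctness of the search *)

Section SearchProgram.
Variables (R : realType) (m n : nat).
Implicit Types s t : state R.

Definition Reached i s v := nmem s labelA 0 v == i.+1.
Definition Marked i s r := nmem s markA 0 r == i.+1.
Definition Searching i s :=
  searching m n (rmem s matA) (nmem s basisA 0) i (Marked i s) (Reached i s)
    (nmem s slotA) (rmem s coefA).
Definition Stuck i s := stuck m n (Marked i s) (Reached i s) (rmem s coefA).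

Lemma start_spec s i : has_dims m n s -> nmem s vi 0 0 = i -> (i < n)%N ->
  reduced m n (rmem s matA) (nmem s basisA 0) ->
  (forall v, (nmem s labelA 0 v <= i)%N) -> (forall r, (nmem s markA 0 r <= i)%N) ->
  Searching i (run start s) /\
  (forall v, nmem (run start s) labelA 0 v = if v == i then i.+1 else nmem s labelA 0 v).
Proof.
move=> hd iE lti red hlab hmark.
pose s1 := run (SetN labelA idx0 get_i (nsucc get_i)) s.
have L1 v : nmem s1 labelA 0 v = if v == i then i.+1 else nmem s labelA 0 v.
  by rewrite /= updateE /= iE addn1.
pose s2 := run start_loop s1.
have E2 : forall r, (r < m)%N -> nmem s2 slotA i r = nmem s basisA 0 r /\
                                 rmem s2 coefA i r = - rmem s matA r i.
  apply: (run_for (s := s1) (d := Rows) (Inv := fun k s' => forall r, (r < k)%N ->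
    nmem s' slotA i r = nmem s basisA 0 r /\ rmem s' coefA i r = - rmem s matA r i) hd) => //.
  move=> k t km fN fR tk I r; rewrite ltnS leq_eqVlt /=.
  rewrite tk !updateE /= (fN vi isT) (fN basisA isT) (fR matA isT) /= !updateE /= iE tk !eqxx sub0r.
  case: (eqVneq r k) => [-> //|rk /= rltk]; first exact: I.
have -> : run start s = storeR coefA i m 1 (storeN slotA i m i s2).
  have [h0 _] : has_dims m n s2 by apply: dims_frame hd _; rewrite /s2 run_frameN.
  have i2 : nmem s2 vi 0 0 = i by rewrite /s2 run_frameN.
  by rewrite -[LHS]/(storeR coefA (nmem s2 vi 0 0) (nmem s2 0 0 0) 1
     (storeN slotA (nmem s2 vi 0 0) (nmem s2 0 0 0) (nmem s2 vi 0 0) s2)) h0 i2.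
set s3 := storeR _ _ _ _ _.
have L3 v : nmem s3 labelA 0 v = if v == i then i.+1 else nmem s labelA 0 v.
  by rewrite /= updateE /= /s2 run_frameN // L1.
split=> //; have M3 : nmem s3 markA = nmem s markA by rewrite /= update_other // /s2 run_frameN.
have B3 : nmem s3 basisA = nmem s basisA by rewrite /= update_other // /s2 run_frameN.
have T3 : rmem s3 matA = rmem s matA by rewrite /= update_other // /s2 run_frameR.
rewrite /Searching B3 T3.
apply: (search_start red lti).
- by move=> r _; rewrite /Marked M3 neq_ltn ltnS hmark.
- move=> v _; rewrite /Reached L3; case: (eqVneq v i) => _; rewrite ?eqxx //.
  by apply: ltn_eqF; apply: hlab.
- move=> r rm; have [<- <-] := E2 r rm.
  by rewrite /= !updateE /= eqxx /= (ltn_eqF rm).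
- by rewrite /= updateE /= !eqxx.
- by rewrite /= updateE /= !eqxx.
Qed.

Lemma create_spec s i u p b : has_dims m n s -> nmem s vi 0 0 = i ->
  nmem s vu 0 0 = u -> nmem s vparent 0 0 = p -> nmem s vrow 0 0 = b ->
  (b < m)%N -> p != u ->
  let s' := run create s in let c := rmem s coefA p b / rmem s matA b u in
  [/\ forall v, v != u -> nmem s' slotA v = nmem s slotA v /\ rmem s' coefA v = rmem s coefA v,
      forall v, nmem s' labelA 0 v = if v == u then i.+1 else nmem s labelA 0 v &
  [/\ forall r, (r < m)%N -> nmem s' slotA u r = (if r == b then p else nmem s slotA p r),
      nmem s' slotA u m = u,
      forall r, (r < m)%N -> rmem s' coefA u r =
        if r == b then rmem s coefA p m else rmem s coefA p r - c * rmem s matA r u &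
      rmem s' coefA u m = c]].
Proof.
move=> hd iE uE pE bE bm pu s' c.
pose s1 := run create_loop s.
have [old1 new1] : (forall v, v != u ->
     nmem s1 slotA v = nmem s slotA v /\ rmem s1 coefA v = rmem s coefA v) /\
  (forall r, (r < m)%N -> nmem s1 slotA u r = nmem s slotA p r /\
     rmem s1 coefA u r = rmem s coefA p r - c * rmem s matA r u).
  apply: (run_for (d := Rows) (Inv := fun k s' => (forall v, v != u ->
       nmem s' slotA v = nmem s slotA v /\ rmem s' coefA v = rmem s coefA v) /\
    (forall r, (r < k)%N -> nmem s' slotA u r = nmem s slotA p r /\
       rmem s' coefA u r = rmem s coefA p r - c * rmem s matA r u)) hd) => //.
  move=> k t km fN fR tk [I1 I2].
  have [I1s I1x] := I1 p pu.
  have -> : storeN vs 0 0 k.+1 (run (SetN slotA get_u get_s (NRead slotA get_parent get_s) ;;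
               SetR coefA get_u get_s (RSub (RRead coefA get_parent get_s)
                 (RMul pivot_ratio (RRead matA get_s get_u)))) t) =
     storeN vs 0 0 k.+1 (storeR coefA u k (rmem s coefA p k - c * rmem s matA k u)
        (storeN slotA u k (nmem s slotA p k) t)).
    by rewrite /= !updateE /= (fN vu isT) (fN vparent isT) (fN vrow isT) (fR matA isT)
      tk uE pE bE I1s I1x.
  split=> [v vu|r].
    have [<- <-] := I1 v vu.
    by split; rewrite /= /update /= (negbTE vu).
  rewrite ltnS leq_eqVlt /= !updateE /= eqxx.
  by case: (eqVneq r k) => [->//|rk /= rltk]; apply: I2.
have -> : s' = storeN labelA 0 u i.+1 (storeR coefA u m c (storeN slotA u m u
     (storeR coefA u b (rmem s coefA p m) (storeN slotA u b p s1)))).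
  have [h0 _] : has_dims m n s1 by apply: dims_frame hd _; rewrite /s1 run_frameN.
  have i1 : nmem s1 vi 0 0 = i by rewrite /s1 run_frameN.
  have u1 : nmem s1 vu 0 0 = u by rewrite /s1 run_frameN.
  have p1 : nmem s1 vparent 0 0 = p by rewrite /s1 run_frameN.
  have b1 : nmem s1 vrow 0 0 = b by rewrite /s1 run_frameN.
  have T1 : rmem s1 matA = rmem s matA by rewrite /s1 run_frameR.
  have X1 : rmem s1 coefA p = rmem s coefA p by have [] := old1 p pu.
  rewrite -[s']/(run (
    SetN slotA get_u get_row get_parent ;;
    SetR coefA get_u get_row (RRead coefA get_parent last_slot) ;;
    SetN slotA get_u last_slot get_u ;;
    SetR coefA get_u last_slot pivot_ratio ;;
    SetN labelA idx0 get_u (nsucc get_i)) s1).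
  move: h0 i1 u1 p1 b1 T1 X1; move: (s1) => [N1 R1] /= h0 i1 u1 p1 b1 T1 X1.
  by rewrite /storeN /storeR /= !updateE /= h0 i1 u1 p1 b1 T1 /update /= (negbTE pu) !X1 addn1.
have L1 : nmem s1 labelA = nmem s labelA by rewrite /s1 run_frameN.
move: old1 new1 L1; move: (s1) => [N1 R1] /= old1 new1 L1; split.
- by move=> v vu; have [<- <-] := old1 v vu; rewrite /update /= (negbTE vu).
- by move=> v; rewrite !updateE /= L1.
split.
- move=> r rm; rewrite !updateE /= eqxx (ltn_eqF rm) /=.
  by case: eqP => // _; have [] := new1 r rm.
- by rewrite !updateE /= !eqxx.
- move=> r rm; rewrite !updateE /= eqxx (ltn_eqF rm) /=.
  by case: eqP => // _; have [] := new1 r rm.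
- by rewrite !updateE /= !eqxx.
Qed.

Definition extends i s b p :=
  [/\ (b < m)%N, ~~ Marked i s b, (p < n)%N, Reached i s p & rmem s coefA p b != 0].

Lemma find_pivot_row_spec s i b : has_dims m n s -> nmem s vi 0 0 = i ->
  nmem s vb 0 0 = b -> (b < m)%N ->
  let s' := run find_pivot_row s in
  (extends i s (nmem s vrow 0 0) (nmem s vparent 0 0) ->
     extends i s (nmem s' vrow 0 0) (nmem s' vparent 0 0)) /\
  ((exists2 v, (v < n)%N & extends i s b v) ->
     extends i s (nmem s' vrow 0 0) (nmem s' vparent 0 0)) /\
  (nmem s' vrow 0 0 = nmem s vrow 0 0 \/
     extends i s (nmem s' vrow 0 0) (nmem s' vparent 0 0)).
Proof.
move=> hd iE bE bm s'.
apply: (run_for (d := Cols) (Inv := fun k s' =>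
  (extends i s (nmem s vrow 0 0) (nmem s vparent 0 0) ->
     extends i s (nmem s' vrow 0 0) (nmem s' vparent 0 0)) /\
  ((exists2 v, (v < k)%N & extends i s b v) ->
     extends i s (nmem s' vrow 0 0) (nmem s' vparent 0 0)) /\
  (nmem s' vrow 0 0 = nmem s vrow 0 0 \/
     extends i s (nmem s' vrow 0 0) (nmem s' vparent 0 0))) hd) => //.
  by split=> //; split; [case|left].
move=> k t kn fN fR tk [I1 [I2 I3]].
rewrite /= tk (fN vb isT) (fN labelA isT) (fN markA isT) (fN vi isT) (fR coefA isT)
  bE iE addn1.
case: ifP => [/and3P[h1 h2 h3]|h].
  have ex : extends i s b k by split.
  by rewrite /= !updateE /= tk; split=> //; split=> //; right.
rewrite !updateE /=; split=> //; split=> // -[v].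
rewrite ltnS leq_eqVlt => /predU1P[->|vk ex]; last by apply: I2; exists v.
by case=> _ h1 _ h2 h3; move: h; rewrite [_ == _]h2 h1 h3.
Qed.

Lemma find_pivot_spec s i : has_dims m n s -> nmem s vi 0 0 = i ->
  let s' := run find_pivot s in
  if (nmem s' vrow 0 0 < m)%N
  then extends i s (nmem s' vrow 0 0) (nmem s' vparent 0 0)
  else Stuck i s.
Proof.
move=> hd iE s'; pose s1 := run (SetN vrow idx0 idx0 last_slot) s.
have hd1 : has_dims m n s1 by apply: dims_frame hd _.
have r1 : nmem s1 vrow 0 0 = m by case: hd.
suff [H1 H2] : ((nmem s' vrow 0 0 < m)%N ->
     extends i s (nmem s' vrow 0 0) (nmem s' vparent 0 0)) /\
   forall b v, (b < m)%N -> (v < n)%N -> extends i s b v -> (nmem s' vrow 0 0 < m)%N.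
  case: ifP => [/H1//|h] r rm nQ v vn Rv; apply/eqP; apply: contraFT h => Xv.
  by apply: (H2 r v).
have -> : s' = run find_pivot_loop s1 by [].
apply: (run_for (s := s1) (d := Rows) (Inv := fun k s' => ((nmem s' vrow 0 0 < m)%N ->
     extends i s (nmem s' vrow 0 0) (nmem s' vparent 0 0)) /\
   forall b v, (b < k)%N -> (v < n)%N -> extends i s b v -> (nmem s' vrow 0 0 < m)%N) hd1) => //.
  by split=> //; rewrite [nmem _ _ _ _]r1 ltnn.
move=> k t km fN fR tk [I1 I2].
have hdt : has_dims m n t by apply: dims_frame hd1 _; apply: fN.
have iE' : nmem t vi 0 0 = i by rewrite fN.
have exE b p : extends i t b p = extends i s b p.
  by rewrite /extends /Marked /Reached (fN labelA isT) (fN markA isT) (fR coefA isT).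
have [] := find_pivot_row_spec hdt iE' tk km.
set t' := run find_pivot_row t; rewrite !exE => J1 [J2 J3].
rewrite /= !updateE /=; split.
  by case: J3 => [E|//]; rewrite E => h; rewrite -E; apply/J1/I1.
move=> b v; rewrite ltnS leq_eqVlt => /predU1P[->|bk] vn ex.
  by have [] : extends i s (nmem t' vrow 0 0) (nmem t' vparent 0 0)
    by apply: J2; exists v => //; rewrite exE.
have := I2 b v bk vn ex; case: J3 => [->//|[]//].
Qed.

Lemma expand_spec s i : has_dims m n s -> nmem s vi 0 0 = i ->
  reduced m n (rmem s matA) (nmem s basisA 0) -> Searching i s ->
  let b := nmem s vrow 0 0 in extends i s b (nmem s vparent 0 0) ->
  let s' := run expand s in
  [/\ Searching i s',
      forall v, nmem s' labelA 0 v = i.+1 \/ nmem s' labelA 0 v = nmem s labelA 0 v &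
      forall r, nmem s' markA 0 r = if r == b then i.+1 else nmem s markA 0 r].
Proof.
move=> hd iE red sr b; set p := nmem s vparent 0 0 => -[bm nQb pn Rp Xpb] s'.
pose s1 := run (SetN markA idx0 get_row (nsucc get_i)) s.
have hd1 : has_dims m n s1 by apply: dims_frame hd _.
have -> : s' = run expand_loop s1.
  by rewrite /s' /expand -[LHS]/(if (nmem s vrow 0 0 < nmem s 0 0 0)%N
    then run expand_loop s1 else s) hd.1 bm.
have [lab [old new]] :
  (forall v, nmem (run expand_loop s1) labelA 0 v =
     if [&& (v < n)%N, ~~ Reached i s v & rmem s matA b v != 0] then i.+1
     else nmem s labelA 0 v) /\
  (forall v, Reached i s v -> nmem (run expand_loop s1) slotA v = nmem s slotA v /\
     rmem (run expand_loop s1) coefA v = rmem s coefA v) /\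
  (forall v, (v < n)%N -> ~~ Reached i s v -> rmem s matA b v != 0 ->
     [/\ forall r, (r < m)%N -> nmem (run expand_loop s1) slotA v r =
           (if r == b then p else nmem s slotA p r),
         nmem (run expand_loop s1) slotA v m = v,
         forall r, (r < m)%N -> rmem (run expand_loop s1) coefA v r =
           if r == b then rmem s coefA p m else
             rmem s coefA p r - rmem s coefA p b / rmem s matA b v * rmem s matA r v &
         rmem (run expand_loop s1) coefA v m = rmem s coefA p b / rmem s matA b v]).
  apply: (run_for (s := s1) (d := Cols) (Inv := fun k t =>
  (forall v, nmem t labelA 0 v =
     if [&& (v < k)%N, ~~ Reached i s v & rmem s matA b v != 0] then i.+1
     else nmem s labelA 0 v) /\
  (forall v, Reached i s v -> nmem t slotA v = nmem s slotA v /\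
     rmem t coefA v = rmem s coefA v) /\
  (forall v, (v < k)%N -> ~~ Reached i s v -> rmem s matA b v != 0 ->
     [/\ forall r, (r < m)%N -> nmem t slotA v r =
           (if r == b then p else nmem s slotA p r),
         nmem t slotA v m = v,
         forall r, (r < m)%N -> rmem t coefA v r =
           if r == b then rmem s coefA p m else
             rmem s coefA p r - rmem s coefA p b / rmem s matA b v * rmem s matA r v &
         rmem t coefA v m = rmem s coefA p b / rmem s matA b v])) hd1) => //.
  move=> k t kn fN fR tk [I1 [I2 I3]].
  have hdt : has_dims m n t by apply: dims_frame hd1 _; apply: fN.
  have it : nmem t vi 0 0 = i by rewrite fN.
  have bt : nmem t vrow 0 0 = b by rewrite fN.
  have pt : nmem t vparent 0 0 = p by rewrite fN.
  have Tt : rmem t matA = rmem s matA by rewrite fR.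
  have -> : run (When (BAnd (BNot (reached get_u)) (nonzero (RRead matA get_row get_u))) create) t =
      if ~~ Reached i s k && (rmem s matA b k != 0) then run create t else t.
    rewrite -[LHS]/(if ~~ (nmem t labelA 0 (nmem t vu 0 0) == nmem t vi 0 0 + 1)%N &&
      (rmem t matA (nmem t vrow 0 0) (nmem t vu 0 0) != 0) then run create t else t).
    by rewrite tk it bt Tt I1 ltnn /= addn1.
  case: ifP => [/andP[nRk Tk]|hk].
    have pk : p != k by apply: contraNneq nRk => <-.
    have [C1 C2 [C3 C4 C5 C6]] := create_spec hdt it tk pt bt bm pk.
    have [ps px] := I2 p Rp.
    move: C1 C2 C3 C4 C5 C6; rewrite Tt ps px; move: (run create t) => t' C1 C2 C3 C4 C5 C6.
    split=> [v|]; first rewrite -[LHS]/(nmem t' labelA 0 v) C2 I1 ltnS [(v <= k)%N]leq_eqVlt.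
      by case: (eqVneq v k) => [->|//]; rewrite nRk Tk.
    split=> [v Rv|v].
      have vk : v != k by apply: contraNneq nRk => <-.
      by rewrite /= update_other //; have [-> ->] := C1 v vk; apply: I2.
    rewrite ltnS leq_eqVlt; case: (eqVneq v k) => [-> _ _ _|vk /= vltk nRv Tv].
      by rewrite /= update_other.
    rewrite /= update_other //; have [-> ->] := C1 v vk; exact: I3.
  rewrite /= !update_other //; split=> [v|].
    rewrite I1 ltnS [(v <= k)%N]leq_eqVlt; case: (eqVneq v k) => [->|//].
    by rewrite ltnn hk.
  split=> // v; rewrite ltnS leq_eqVlt; case: (eqVneq v k) => [-> _ h1 h2|_ /=].
    by move: hk; rewrite h1 h2.
  exact: I3.
set t := run expand_loop s1 in lab old new *.
have B : nmem t basisA = nmem s basisA by rewrite /t run_frameN.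
have T : rmem t matA = rmem s matA by rewrite /t run_frameR.
have M r : nmem t markA 0 r = if r == b then i.+1 else nmem s markA 0 r.
  by rewrite /t run_frameN //= updateE /= iE addn1.
have RE v : (v < n)%N -> Reached i t v = Reached i s v || (rmem s matA b v != 0).
  move=> vn; rewrite /Reached lab vn /= -/(Reached i s v).
  case: (boolP (Reached i s v)) => [//|nR] /=.
  by case: ifP => _; [rewrite eqxx|exact: negbTE].
split=> //; last by move=> v; rewrite lab; case: ifP => _; [left|right].
rewrite /Searching B T.
apply: (search_step red sr bm nQb pn Rp Xpb) => //.
- move=> r rm; rewrite /Marked M; case: (eqVneq r b) => _; rewrite ?eqxx ?orbT //.
  by rewrite orbF.
- by move=> v vn; apply: old.
- have Ri := search_source sr; move: (Ri).
  rewrite /Reached lab -/(Reached i s i) => /eqP ->.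
  by rewrite Ri andbF eqxx.
Qed.

(** A round either uses a new row or changes nothing, so after [m] rounds all rows
    are used or the search is stuck; in the first case it is stuck as well. *)
Lemma search_spec s i : has_dims m n s -> nmem s vi 0 0 = i -> (i < n)%N ->
  reduced m n (rmem s matA) (nmem s basisA 0) ->
  (forall v, (nmem s labelA 0 v <= i)%N) -> (forall r, (nmem s markA 0 r <= i)%N) ->
  let s' := run search s in
  [/\ Searching i s', Stuck i s',
      forall v, nmem s' labelA 0 v = i.+1 \/ nmem s' labelA 0 v = nmem s labelA 0 v &
      forall r, (nmem s' markA 0 r <= i.+1)%N].
Proof.
move=> hd iE lti red hlab hmark s'.
have [S1 L1] := start_spec hd iE lti red hlab hmark.
pose s1 := run start s.
have hd1 : has_dims m n s1 by apply: dims_frame hd _; rewrite /s1 run_frameN.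
pose Inv k s' := [/\ Searching i s', (Stuck i s' \/ (k <= count (Marked i s') (iota 0 m))%N),
      forall v, nmem s' labelA 0 v = i.+1 \/ nmem s' labelA 0 v = nmem s labelA 0 v &
      forall r, (nmem s' markA 0 r <= i.+1)%N].
suff [H1 H2 H3 H4] : Inv m (run rounds s1).
  split=> //; case: H2 => // hc r rm nQ.
  have : all (Marked i (run rounds s1)) (iota 0 m).
    by rewrite all_count eqn_leq count_size size_iota.
  by move=> /allP/(_ r); rewrite mem_iota rm => /(_ isT) Qr; rewrite Qr in nQ.
apply: (run_for (s := s1) (d := Rows) (Inv := Inv) hd1) => //.
  split=> //; first by right.
    by move=> v; rewrite [nmem _ _ _ _]L1; case: ifP; [left|right].
  by move=> r; rewrite -[nmem _ _ _ _]/(nmem s1 markA 0 r) /s1 run_frameN // leqW.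
move=> k t km fN fR tk [I1 I2 I3 I4].
have hdt : has_dims m n t by apply: dims_frame hd1 _; apply: fN.
have it : nmem t vi 0 0 = i by rewrite fN // /s1 run_frameN.
have redt : reduced m n (rmem t matA) (nmem t basisA 0).
  by rewrite fN // fR // /s1 run_frameN // run_frameR.
pose t1 := run find_pivot t.
change (Inv k.+1 (storeN vround 0 0 k.+1 (run expand t1))).
suff : Inv k.+1 (run expand t1) by [].
have fs := find_pivot_spec hdt it; rewrite /= -/t1 in fs.
have hd1' : has_dims m n t1 by apply: dims_frame hdt _; rewrite /t1 run_frameN.
have it1 : nmem t1 vi 0 0 = i by rewrite /t1 run_frameN.
have lt1 : nmem t1 labelA = nmem t labelA by rewrite /t1 run_frameN.
have mt1 : nmem t1 markA = nmem t markA by rewrite /t1 run_frameN.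
have st1 : nmem t1 slotA = nmem t slotA by rewrite /t1 run_frameN.
have xt1 : rmem t1 coefA = rmem t coefA by rewrite /t1 run_frameR.
have Tt1 : rmem t1 matA = rmem t matA by rewrite /t1 run_frameR.
have Bt1 : nmem t1 basisA = nmem t basisA by rewrite /t1 run_frameN.
have S1' : Searching i t1.
  by rewrite /Searching /Reached /Marked lt1 mt1 st1 xt1 Tt1 Bt1.
have exE b p : extends i t1 b p = extends i t b p.
  by rewrite /extends /Marked /Reached lt1 mt1 xt1.
case: ifP fs => [wm ex|wm st].
  rewrite -exE in ex.
  rewrite -Tt1 -Bt1 in redt.
  have [J1 J2 J3] := expand_spec hd1' it1 redt S1' ex.
  have [_ nQb _ _ _] := ex; rewrite exE in ex.
  set b := nmem t1 vrow 0 0 in wm J3 nQb ex.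
  split=> //.
  - case: I2 => [st|ck].
      by case: ex => _ nQ pn Rp; rewrite st ?eqxx.
    right.
    have Mb r : Marked i (run expand t1) r = Marked i t r || (r == b).
      rewrite /Marked J3 mt1; case: (eqVneq r b) => _; rewrite ?eqxx ?orbT //.
      by rewrite orbF.
    rewrite (eq_count (a2 := predU (Marked i t) (pred1 b))); last by move=> r; rewrite /= Mb.
    have := count_predUI (Marked i t) (pred1 b) (iota 0 m).
    rewrite count_uniq_mem ?iota_uniq // mem_iota wm addn1.
    rewrite [count (predI _ _) _](eq_count (a2 := pred0)) ?count_pred0 ?addn0 => [->//|r /=].
    rewrite /Marked -mt1; case: (eqVneq r b) => [->|]; last by rewrite andbF.
    by rewrite andbT; apply: negbTE.
  - by move=> v; case: (J2 v) => [->|->]; [left|rewrite lt1].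
  - by move=> r; rewrite J3; case: ifP => // _; rewrite mt1.
have -> : run expand t1 = t1.
  by rewrite -[LHS]/(if (nmem t1 vrow 0 0 < nmem t1 0 0 0)%N then
    run (SetN markA idx0 get_row (nsucc get_i) ;; expand_loop) t1 else t1) hd1'.1 wm.
split=> //; last by move=> r; rewrite mt1.
  by left; rewrite /Stuck /Marked /Reached mt1 lt1 xt1.
by rewrite lt1.
Qed.
End SearchProgram.

(** * Correctness of the output *)

Section Emit.
Variables (R : realType) (m n p : nat) (A : 'M[R]_(p, n)).
Implicit Types (s t : state R) (gs : seq 'cV[R]_n) (g : 'cV[R]_n).

Definition lists_family gs s :=
  nmem s countA 0 0 = size gs /\
  forall k, (k < size gs)%N ->
    perm_eq [seq nmem s listA k l | l <- iota 0 (nmem s sizeA 0 k)]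
            [seq val j | j in supp (nth 0 gs k)].

Definition is_table gs (K : nat -> nat -> R) := forall i j : 'I_n,
  (forall g, g \in gs -> g i 0 != 0 -> g j 0 != 0 -> `|g j 0 / g i 0| <= K i j) /\
  (K i j = 0 \/ exists g, [/\ g \in gs, g i 0 != 0, g j 0 != 0 &
                              K i j = `|g j 0 / g i 0|]).

Definition output gs s :=
  [/\ lists_family gs s, is_table gs (rmem s tableA) &
      forall g, g \in gs -> elementary (ker A) g].

Lemma update_entry_spec s u r c : nmem s vu 0 0 = u -> nmem s vs 0 0 = r ->
  nmem s vt 0 0 = c ->
  let e := nmem s slotA u in let x := rmem s coefA u in
  forall a b, rmem (run update_entry s) tableA a b =
    if [&& a == e r, b == e c & rmem s tableA a b < `|x c / x r|] then `|x c / x r|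
    else rmem s tableA a b.
Proof.
move=> uE rE cE e x a b; set v := x c / x r.
pose s2 := run (SetR tmpA idx0 idx0 (RDiv (RRead coefA get_u get_t) (RRead coefA get_u get_s)) ;;
  When (RLt tmp (RConst 0)) (SetR tmpA idx0 idx0 (RSub (RConst 0) tmp))) s.
have N2 : nmem s2 = nmem s by rewrite /s2 /=; case: ifP.
have K2 : rmem s2 tableA = rmem s tableA by rewrite /s2 run_frameR.
have v2 : rmem s2 tmpA 0 0 = `|v|.
  rewrite /s2 /= !updateE /= uE rE cE -/e -/x -/v.
  case: ifP => v0; rewrite /= !updateE /=; first by rewrite sub0r ltr0_norm.
  by rewrite ger0_norm // leNgt v0.
have -> : rmem (run update_entry s) tableA a b =
    rmem (if rmem s tableA (e r) (e c) < `|v| then storeR tableA (e r) (e c) `|v| s2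
          else s2) tableA a b.
  rewrite -[run update_entry s]/(if rmem s2 tableA (nmem s2 slotA (nmem s2 vu 0 0) (nmem s2 vs 0 0))
     (nmem s2 slotA (nmem s2 vu 0 0) (nmem s2 vt 0 0)) < rmem s2 tmpA 0 0
   then storeR tableA (nmem s2 slotA (nmem s2 vu 0 0) (nmem s2 vs 0 0))
     (nmem s2 slotA (nmem s2 vu 0 0) (nmem s2 vt 0 0)) (rmem s2 tmpA 0 0) s2 else s2).
  by rewrite N2 K2 v2 uE rE cE.
rewrite -K2.
case: (eqVneq a (e r)) => [->|ar] /=; last by case: ifP => // _; rewrite /= updateE (negbTE ar).
case: (eqVneq b (e c)) => [->|br] /=; last first.
  by case: ifP => // _; rewrite /= updateE (negbTE br) andbF.
by case: ifP => // _; rewrite /= updateE !eqxx.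
Qed.

(** The effect on the table of processing any part of the pairs of entries of a
    new vector.  It is preserved by processing further pairs, and with it the
    bounds from the vectors seen before and the attainment of the values. *)
Definition table_grows (e : nat -> nat) (x : nat -> R) (K K' : nat -> nat -> R) :=
  forall a b, K a b <= K' a b /\
    [\/ K' a b = K a b, K' a b = 0 |
        exists r c, [/\ (r < m.+1)%N, (c < m.+1)%N, x r != 0 & x c != 0] /\
                    [/\ e r = a, e c = b & K' a b = `|x c / x r|]].

Lemma table_grows_refl e x K : table_grows e x K K.
Proof. by move=> a b; split=> //; constructor 1. Qed.

Lemma table_grows_trans e x K K' K'' :
  table_grows e x K K' -> table_grows e x K' K'' -> table_grows e x K K''.
Proof.
move=> h1 h2 a b; have [l1 u1] := h1 a b; have [l2 u2] := h2 a b.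
split; first exact: le_trans l2.
by case: u2 => [->|->|h] //; [constructor 2|constructor 3].
Qed.

Lemma entries_spec s u r : has_dims m n s -> nmem s vu 0 0 = u ->
  nmem s vs 0 0 = r -> (r < m.+1)%N ->
  let e := nmem s slotA u in let x := rmem s coefA u in
  x r != 0 ->
  table_grows e x (rmem s tableA) (rmem (run entries s) tableA) /\
  forall c, (c < m.+1)%N -> `|x c / x r| <= rmem (run entries s) tableA (e r) (e c).
Proof.
move=> hd uE rE rm e x xr.
apply: (run_for (d := Slots) (Inv := fun k t =>
  table_grows e x (rmem s tableA) (rmem t tableA) /\
  forall c, (c < k)%N -> `|x c / x r| <= rmem t tableA (e r) (e c)) hd) => //.
  by split=> //; apply: table_grows_refl.
move=> k t km fN fR tk [I1 I2].
have uE' : nmem t vu 0 0 = u by rewrite fN.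
have rE' : nmem t vs 0 0 = r by rewrite fN.
have := update_entry_spec uE' rE' tk.
cbv zeta; rewrite (fN slotA isT) (fR coefA isT) -/e -/x.
move: (run update_entry t) => t' spec.
have grow : table_grows e x (rmem t tableA) (rmem t' tableA).
  move=> a b; rewrite spec; case: ifP => [/and3P[/eqP-> /eqP-> lt]|_]; last first.
    by split=> //; constructor 1.
  split; first exact: ltW.
  have [x0|xk] := eqVneq (x k) 0; first by constructor 2; rewrite x0 mul0r normr0.
  by constructor 3; exists r, k.
suff : table_grows e x (rmem s tableA) (rmem t' tableA) /\
  forall c, (c < k.+1)%N -> `|x c / x r| <= rmem t' tableA (e r) (e c) by [].
split; first exact: table_grows_trans grow.
move=> c; rewrite ltnS leq_eqVlt => /predU1P[->|ck].
  by rewrite spec !eqxx /=; case: ltP.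
apply: le_trans (I2 c ck) _; by have [] := grow (e r) (e c).
Qed.

Lemma emit_entry_spec s u r k0 : has_dims m n s -> nmem s vu 0 0 = u ->
  nmem s vs 0 0 = r -> (r < m.+1)%N -> nmem s countA 0 0 = k0 ->
  let e := nmem s slotA u in let x := rmem s coefA u in let s' := run emit_entry s in
  let z := nmem s sizeA 0 k0 in
  [/\ forall k, nmem s' sizeA 0 k = if k == k0 then (z + (x r != 0%R))%N else nmem s sizeA 0 k,
      forall k l, nmem s' listA k l =
        if [&& k == k0, l == z & x r != 0] then e r else nmem s listA k l,
      table_grows e x (rmem s tableA) (rmem s' tableA) &
      x r != 0 -> forall c, (c < m.+1)%N -> `|x c / x r| <= rmem s' tableA (e r) (e c)].
Proof.
move=> hd uE rE rm kE e x s' z.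
pose s1 := run (SetN listA get_count list_size (NRead slotA get_u get_s) ;;
     SetN sizeA idx0 get_count (nsucc list_size)) s.
have sE : s' = if x r != 0 then run entries s1 else s.
  by rewrite -[s']/(if rmem s coefA (nmem s vu 0 0) (nmem s vs 0 0) != 0
                    then run entries s1 else s) uE rE.
rewrite sE; case: ifP => xr; last first.
  by split=> // [k|k l|]; rewrite ?addn0 ?andbF //; [case: eqP => [->|]|apply: table_grows_refl].
have hd1 : has_dims m n s1 by apply: dims_frame hd _.
have e1 : nmem s1 slotA u = e by [].
have x1 : rmem s1 coefA u = x by [].
have [] := entries_spec hd1 uE rE rm; rewrite ?e1 ?x1 // => T1 T2.
split=> // [k|k l].
  by rewrite run_frameN //= !updateE /= kE.
by rewrite run_frameN //= !updateE /= kE uE rE andbT.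
Qed.

Lemma emitE s : run emit s =
  let s1 := run emit_loop (run (SetN sizeA idx0 get_count idx0) s) in
  storeN countA 0 0 (nmem s1 countA 0 0 + 1)%N s1.
Proof. by []. Qed.

Lemma iota_rcons k : iota 0 k.+1 = rcons (iota 0 k) k.
Proof. by rewrite -addn1 iotaD cats1. Qed.

Lemma emit_spec s u k0 : has_dims m n s -> nmem s vu 0 0 = u ->
  nmem s countA 0 0 = k0 ->
  let e := nmem s slotA u in let x := rmem s coefA u in let s' := run emit s in
  [/\ nmem s' countA 0 0 = k0.+1,
      forall k, k != k0 -> nmem s' sizeA 0 k = nmem s sizeA 0 k /\
                           nmem s' listA k = nmem s listA k,
      [seq nmem s' listA k0 l | l <- iota 0 (nmem s' sizeA 0 k0)] =
        [seq e r | r <- iota 0 m.+1 & x r != 0],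
      table_grows e x (rmem s tableA) (rmem s' tableA) &
      forall r c, (r < m.+1)%N -> (c < m.+1)%N -> x r != 0 ->
        `|x c / x r| <= rmem s' tableA (e r) (e c)].
Proof.
move=> hd uE kE e x s'; pose s1 := run (SetN sizeA idx0 get_count idx0) s.
have hd1 : has_dims m n s1 by apply: dims_frame hd _.
have z1 k : nmem s1 sizeA 0 k = if k == k0 then 0%N else nmem s sizeA 0 k.
  by rewrite /= updateE /= kE.
pose Inv k t := [/\ forall k, k != k0 -> nmem t sizeA 0 k = nmem s sizeA 0 k /\
                           nmem t listA k = nmem s listA k,
      [seq nmem t listA k0 l | l <- iota 0 (nmem t sizeA 0 k0)] =
        [seq e r | r <- iota 0 k & x r != 0],
      table_grows e x (rmem s tableA) (rmem t tableA) &
      forall r c, (r < k)%N -> (c < m.+1)%N -> x r != 0 ->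
        `|x c / x r| <= rmem t tableA (e r) (e c)].
suff [J1 J2 J3 J4] : Inv m.+1 (run emit_loop s1).
  have -> : s' = storeN countA 0 0 k0.+1 (run emit_loop s1).
    rewrite /s' emitE -/s1; cbv zeta; rewrite run_frameN //.
    by rewrite -[nmem s1 _ _ _]/(nmem s countA 0 0) kE addn1.
  by split.
apply: (run_for (d := Slots) (Inv := Inv) hd1) => //.
  split=> //; last exact: table_grows_refl.
    by move=> k kk0; rewrite [nmem _ sizeA _ _]z1 (negbTE kk0).
  by rewrite [nmem _ sizeA _ _]z1 eqxx.
move=> k t km fN fR tk [I1 I2 I3 I4].
have hdt : has_dims m n t by apply: dims_frame hd1 _; apply: fN.
have ut : nmem t vu 0 0 = u by rewrite fN.
have ct : nmem t countA 0 0 = k0 by rewrite fN.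
have et : nmem t slotA u = e by rewrite fN.
have xt : rmem t coefA u = x by rewrite fR.
have := emit_entry_spec hdt ut tk km ct.
cbv zeta; rewrite et xt; move: (run emit_entry t) => t' [S1 S2 S3 S4].
suff : Inv k.+1 t' by [].
split.
- move=> l lk0; have [<- <-] := I1 l lk0; split; first by rewrite S1 (negbTE lk0).
  by apply/funext => j; rewrite S2 (negbTE lk0).
- rewrite S1 eqxx iota_rcons filter_rcons; set z := nmem t sizeA 0 k0.
  have old : [seq nmem t' listA k0 l | l <- iota 0 z] = [seq nmem t listA k0 l | l <- iota 0 z].
    apply/eq_in_map => l; rewrite mem_iota add0n => /andP[_ lz].
    by rewrite S2 -/z (ltn_eqF lz) andbF.
  case: ifP => xk; last by rewrite addn0 old I2.
  by rewrite addn1 iota_rcons !map_rcons old I2 S2 !eqxx xk.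
- exact: table_grows_trans S3.
- move=> r c; rewrite ltnS leq_eqVlt => /predU1P[->|rk] cm xr; first exact: S4.
  apply: le_trans (I4 r c rk cm xr) _; by have [] := S3 (e r) (e c).
Qed.

End Emit.

Section Main.
Variables (R : realType) (m n : nat) (A : 'M[R]_(m, n)).
Implicit Types (s t : state R) (gs : seq 'cV[R]_n) (g : 'cV[R]_n).

Definition covers gs (a b : 'I_n) :=
  exists2 g, g \in gs & (g a 0 != 0) && (g b 0 != 0).

Lemma covers_rcons gs g a b : covers gs a b -> covers (rcons gs g) a b.
Proof. by case=> h hg hab; exists h => //; rewrite mem_rcons inE hg orbT. Qed.

(** The slots of a node hold distinct indices, so that the list enumerates the
    support of its vector and the table sees each pair of its entries once. *)
Lemma emit_output s gs i u T B Q Rc : has_dims m n s -> nmem s vu 0 0 = u ->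
  (u < n)%N -> u <> i -> ker (mat m n T) = ker A ->
  node m n T B Q Rc i u (nmem s slotA u) (rmem s coefA u) ->
  output A gs s ->
  output A (rcons gs (sparse n m.+1 (nmem s slotA u) (rmem s coefA u))) (run emit s).
Proof.
move=> hd uE un ui kT nd [[fc fl] tab el].
have [cE old new grow low] := emit_spec hd uE fc.
set e := nmem s slotA u in nd new grow low *.
set x := rmem s coefA u in nd new grow low *.
set g := sparse _ _ _ _; set s' := run emit s in cE old new grow low *.
have inj := node_inj nd ui.
have lte := node_slot_lt nd un.
have gE r (c : 'I_n) : (r < m.+1)%N -> e r = c -> g c 0 = x r.
  exact: sparse_at inj.
have slot (c : 'I_n) : g c 0 != 0 -> exists r, [/\ (r < m.+1)%N, e r = c & x r != 0].
  by rewrite -in_supp => /(node_supp nd ui).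
split.
- split=> [|k]; first by rewrite size_rcons.
  rewrite size_rcons ltnS leq_eqVlt nth_rcons => /predU1P[->|ks].
    rewrite ltnn eqxx new; apply: uniq_perm.
    + rewrite map_inj_in_uniq ?filter_uniq ?iota_uniq // => a b.
      rewrite !mem_filter !mem_iota !add0n => /andP[_ /andP[_ am]] /andP[_ /andP[_ bm]].
      exact: inj.
    + by rewrite (map_inj_uniq val_inj) enum_uniq.
    move=> a; apply/mapP/mapP => [[r]|[c]].
      rewrite mem_filter mem_iota add0n => /andP[xr /andP[_ rm]] ->.
      exists (Ordinal (lte r rm)) => //; rewrite mem_enum.
      by apply/(node_supp nd ui); exists r.
    rewrite mem_enum => /(node_supp nd ui)[r [rm er xr]] ->; exists r => //.
    by rewrite mem_filter xr mem_iota add0n.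
  rewrite ks; have [|-> ->] := old k; first by rewrite ltn_eqF.
  exact: fl.
- move=> i0 j0; have [lo up] := tab i0 j0; have [mono upg] := grow i0 j0; split.
    move=> h; rewrite mem_rcons inE => /predU1P[->|hg] h1 h2; last first.
      exact: le_trans (lo h hg h1 h2) mono.
    have [r [rm er xr]] := slot _ h1; have [c [cm ec xc]] := slot _ h2.
    rewrite (gE r i0) // (gE c j0) //.
    by have := low r c rm cm xr; rewrite er ec.
  case: upg => [->|->|[r [c [[rm cm xr xc] [er ec ->]]]]]; [|by left|].
    case: up => [->|[h [hg h1 h2 ->]]]; first by left.
    by right; exists h; rewrite mem_rcons inE hg orbT.
  right; exists g; rewrite mem_rcons inE eqxx.
  by rewrite (gE r i0) // (gE c j0).
- move=> h; rewrite mem_rcons inE => /predU1P[->|/el//].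
  by rewrite -kT; apply: node_elementary nd ui un.
Qed.

Lemma emit_all_spec s gs i : has_dims m n s -> nmem s vi 0 0 = i -> (i < n)%N ->
  ker (mat m n (rmem s matA)) = ker A -> Searching m n i s -> output A gs s ->
  exists gs', [/\ output A gs' (run emit_all s),
    forall a b, covers gs a b -> covers gs' a b &
    forall a b : 'I_n, a = i :> nat -> Reached i s b -> a != b -> covers gs' a b].
Proof.
move=> hd iE lti kT sr out.
suff [gs' [O1 O2 O3]] : exists gs', [/\ output A gs' (run emit_all s),
    forall a b, covers gs a b -> covers gs' a b &
    forall a b : 'I_n, a = i :> nat -> (b < n)%N -> Reached i s b -> a != b -> covers gs' a b].
  by exists gs'; split=> // a b ai; apply: O3.
apply: (run_for (d := Cols) (Inv := fun k t => exists gs', [/\ output A gs' t,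
    forall a b, covers gs a b -> covers gs' a b &
    forall a b : 'I_n, a = i :> nat -> (b < k)%N -> Reached i s b -> a != b ->
      covers gs' a b]) hd) => //.
  by exists gs; split.
move=> k t kn fN fR tk [gs' [O1 O2 O3]].
have hdt : has_dims m n t by apply: dims_frame hd _; apply: fN.
have -> : run (When (BAnd (reached get_u) (BNot (NEq get_u get_i))) emit) t =
    if Reached i s k && (k != i) then run emit t else t.
  rewrite -[LHS]/(if (nmem t labelA 0 (nmem t vu 0 0) == nmem t vi 0 0 + 1)%N &&
    (nmem t vu 0 0 != nmem t vi 0 0) then run emit t else t).
  by rewrite tk (fN vi isT) iE (fN labelA isT) addn1.
case: ifP => [/andP[Rk /eqP ki]|hk].
  have et : nmem t slotA = nmem s slotA by rewrite fN.
  have xt : rmem t coefA = rmem s coefA by rewrite fR.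
  have nd := search_node sr kn Rk; rewrite -et -xt in nd.
  have := emit_output hdt tk kn ki kT nd O1; set g := sparse _ _ _ _ => O1'.
  exists (rcons gs' g); split=> // [a b /O2|a b ai]; first exact: covers_rcons.
  rewrite ltnS leq_eqVlt => /predU1P[bk|bk] Rb ab; last first.
    by apply: covers_rcons; apply: O3.
  exists g; first by rewrite mem_rcons inE eqxx.
  have lta : (i < n)%N by [].
  have := node_mem_source nd ki lta; have := node_mem_target nd ki kn.
  have -> : Ordinal lta = a by apply: val_inj.
  have -> : Ordinal kn = b by apply: val_inj.
  by rewrite !in_supp => -> ->.
exists gs'; split=> // a b ai; rewrite ltnS leq_eqVlt => /predU1P[bk|bk] Rb ab.
  move: hk; rewrite -bk Rb -ai => /= /negbFE /eqP ba.
  by case/eqP: ab; apply: val_inj.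
exact: O3.
Qed.

(** The set of the indices with a given label stays closed when a source relabels
    its whole class; at the end every index has been labelled, by a source of its
    class. *)
Lemma main_loop_spec s : has_dims m n s ->
  ker (mat m n (rmem s matA)) = ker A -> reduced m n (rmem s matA) (nmem s basisA 0) ->
  (forall v, nmem s labelA 0 v = 0%N) -> (forall r, nmem s markA 0 r = 0%N) ->
  output A [::] s ->
  let L := linked m n (rmem s matA) in let s' := run main_loop s in
  exists gs, [/\ output A gs s',
    forall a b : 'I_n, nmem s' labelA 0 a = nmem s' labelA 0 b <-> L a b &
    forall a b : 'I_n, L a b -> a != b -> covers gs a b].
Proof.
move=> hd kT red lab0 mark0 out0 L s'.
pose Inv k t := exists gs, [/\ output A gs t,
    forall v, (nmem t labelA 0 v <= k)%N, forall r, (nmem t markA 0 r <= k)%N &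
    [/\ forall l, row_closed m n (rmem s matA) (fun v => nmem t labelA 0 v == l),
      forall v, (v < n)%N -> nmem t labelA 0 v != 0%N -> L (nmem t labelA 0 v).-1 v,
      forall v, (v < k)%N -> nmem t labelA 0 v != 0%N &
      forall a b : 'I_n, (a < k)%N -> L a b -> a != b -> covers gs a b]].
suff [gs [O1 O2 O3 [O4 O5 O6 O7]]] : Inv n s'.
  exists gs; split=> // [a b|a b]; last exact: O7.
  split=> [ab|Lab]; last by apply/esym/eqP; apply: (Lab _ (O4 _)).
  have la := O5 a (ltn_ord a) (O6 a (ltn_ord a)).
  have lb := O5 b (ltn_ord b) (O6 b (ltn_ord b)).
  by rewrite -ab in lb; apply: linked_trans lb; apply: linked_sym.
apply: (run_for (d := Cols) (Inv := Inv) hd) => //.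
  exists [::]; split=> // [v|r|]; first by rewrite [nmem _ _ _ _]lab0.
    by rewrite [nmem _ _ _ _]mark0.
  split=> // [l r u v _ _ _ _ _|v _]; first by rewrite ![nmem _ labelA _ _]lab0.
  by rewrite [nmem _ labelA _ _]lab0.
move=> k t kn fN fR tk [gs [O1 O2 O3 [O4 O5 O6 O7]]].
have hdt : has_dims m n t by apply: dims_frame hd _; apply: fN.
have Bt : nmem t basisA = nmem s basisA by rewrite fN.
have Tt : rmem t matA = rmem s matA by rewrite fR.
have redt : reduced m n (rmem t matA) (nmem t basisA 0) by rewrite Bt Tt.
have [] := search_spec hdt tk kn redt O2 O3.
pose t1 := run search t; rewrite -/t1 => S1 St L1 M1.
have hd1 : has_dims m n t1 by apply: dims_frame hdt _; rewrite /t1 run_frameN.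
have k1 : nmem t1 vi 0 0 = k by rewrite /t1 run_frameN.
have B1 : nmem t1 basisA = nmem t basisA by rewrite /t1 run_frameN.
have T1 : rmem t1 matA = rmem t matA by rewrite /t1 run_frameR.
have out1 : output A gs t1.
  case: O1 => [[c1 c2] c3 c4]; split=> //; last by rewrite /t1 run_frameR.
  by split=> [|j js]; rewrite /t1 !run_frameN //; apply: c2.
have RL v : (v < n)%N -> Reached k t1 v <-> L k v.
  move=> vn; have := search_end S1 St vn; rewrite T1 Tt; apply.
have kT1 : ker (mat m n (rmem t1 matA)) = ker A by rewrite T1 Tt.
have [gs' [E1 E2 E3]] := emit_all_spec hd1 k1 kn kT1 S1 out1.
pose t2 := run emit_all t1.
suff : Inv k.+1 t2 by [].
have lab2 : nmem t2 labelA = nmem t1 labelA by rewrite /t2 run_frameN.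
have mark2 : nmem t2 markA = nmem t1 markA by rewrite /t2 run_frameN.
have nR v : ~~ Reached k t1 v -> nmem t1 labelA 0 v = nmem t labelA 0 v.
  by move=> nRv; case: (L1 v) => // h; move: nRv; rewrite /Reached h eqxx.
exists gs'; split=> // [v|r|].
- by rewrite lab2; case: (L1 v) => [->//|->]; apply: leqW.
- by rewrite mark2.
split.
- move=> l r u w rm un wn Tu Tw; rewrite lab2.
  have RR : Reached k t1 u = Reached k t1 w.
    apply/idP/idP => [/(RL u un)|/(RL w wn)] Lk; apply/RL => //.
      by apply: linked_trans Lk _; apply: (linked_row rm).
    by apply: linked_trans Lk _; apply: (linked_row rm).
  case: (boolP (Reached k t1 u)) => Ru.
    have Rw : Reached k t1 w by rewrite -RR.
    by rewrite (eqP Ru) (eqP Rw).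
  rewrite !nR -?RR //; exact: (O4 l r).
- move=> v vn; rewrite lab2; case: (boolP (Reached k t1 v)) => Rv.
    by rewrite (eqP Rv) /= => _; apply/RL.
  by rewrite nR //; apply: O5.
- move=> v; rewrite lab2 ltnS leq_eqVlt => /predU1P[->|vk].
    by have := search_source S1; rewrite /Reached => /eqP->.
  by case: (L1 v) => ->//; apply: O6.
- move=> a b; rewrite ltnS leq_eqVlt => /predU1P[ak|ak] Lab ab.
    by apply: E3 => //; apply/RL => //; rewrite -ak.
  by apply: E2; apply: O7.
Qed.

Lemma find_circuits_spec : row_free A ->
  let s := run find_circuits (input A) in
  exists gs (T : 'M[R]_(m, n)), [/\ output A gs s,
    forall a b : 'I_n, nmem s labelA 0 a = nmem s labelA 0 b -> a != b -> covers gs a b,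
    ker T = ker A &
    forall (q : 'I_m) (a b : 'I_n), T q a != 0 -> T q b != 0 ->
      nmem s labelA 0 a = nmem s labelA 0 b].
Proof.
move=> fr s.
have hd : has_dims m n (input A) by [].
have AE : mat m n (rmem (input A) matA) = A.
  by apply/matrixP => i j; rewrite mxE /= !valK.
have frA : row_free (mat m n (rmem (input A) matA)) by rewrite AE.
have [eT red] := gauss_spec hd frA.
set s1 := run gauss (input A) in eT red.
have hd1 : has_dims m n s1 by apply: dims_frame hd _; rewrite /s1 run_frameN.
have kT : ker (mat m n (rmem s1 matA)) = ker A by rewrite (eqmx_ker eT) AE.
have lab1 v : nmem s1 labelA 0 v = 0%N by rewrite /s1 run_frameN.
have mark1 v : nmem s1 markA 0 v = 0%N by rewrite /s1 run_frameN.
have out1 : output A [::] s1.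
  split=> //; first by split=> //; rewrite /s1 run_frameN.
  move=> i j; split=> //; left; rewrite /s1 run_frameR //=.
have [gs [O1 O2 O3]] := main_loop_spec hd1 kT red lab1 mark1 out1.
exists gs, (mat m n (rmem s1 matA)); split=> // [a b /O2|q a b]; first exact: O3.
by rewrite !mxE => qa qb; apply/O2; apply: (linked_row (ltn_ord q)).
Qed.

End Main.

(** * Components *)

Section Components.
Variables (R : realType) (m n : nat) (A T : 'M[R]_(m, n)) (lab : 'I_n -> nat).
Hypothesis kerTA : ker T = ker A.
Hypothesis lab_row : forall (q : 'I_m) (a b : 'I_n), T q a != 0 -> T q b != 0 -> lab a = lab b.

Let P := preim_partition lab [set: 'I_n]%SET.

Lemma components_partition : finset.partition P [set: 'I_n]%SET.
Proof. exact: preim_partitionP. Qed.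

Lemma mem_component S i j : S \in P -> i \in S -> (j \in S) = (lab j == lab i).
Proof.
have /and3P[_ tI _] := components_partition.
move=> SP iS; rewrite -(def_pblock tI SP iS) pblock_equivalence_partition ?inE //.
by move=> x y z _ _ _; split=> // /eqP->.
Qed.

Lemma component_of i : exists2 S, S \in P & i \in S.
Proof.
have /and3P[/eqP cov _ _] := components_partition.
exists (finset.pblock P i); first by rewrite finset.pblock_mem // cov inE.
by rewrite finset.mem_pblock cov inE.
Qed.

Definition restrict (S : {set 'I_n}) (g : 'cV[R]_n) : 'cV[R]_n :=
  \col_c (if c \in S then g c 0 else 0).

Lemma supp_restrict S g : supp (restrict S g) = (supp g :&: S)%SET.
Proof.
by apply/finset.setP => c; rewrite !inE mxE; case: (c \in S); rewrite ?andbT ?andbF ?eqxx.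
Qed.

(** The equation expressed by a row of [T] involves the indices of one component
    only: restriction leaves it unchanged or makes it trivial. *)
Lemma restrict_ker S g : S \in P -> ker A g -> ker A (restrict S g).
Proof.
rewrite -kerTA /ker /= => SP kg; apply/matrixP => q j; rewrite ord1 !mxE.
have := congr1 (fun M : 'cV[R]_m => M q 0) kg; rewrite /= !mxE => kq.
case: (pickP [pred c in S | T q c != 0]) => [c /andP[cS Tc]|none].
  rewrite -[RHS]kq; apply: eq_bigr => d _; rewrite mxE.
  have [->|Td] := eqVneq (T q d) 0; first by rewrite !mul0r.
  by rewrite (mem_component d SP cS) (lab_row Td Tc) eqxx.
rewrite big1 // => d _; rewrite mxE; case: ifP => dS; last by rewrite mulr0.
by have := none d; rewrite /= dS => /negbFE/eqP->; rewrite mul0r.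
Qed.

(** The restriction of [g] to the component is a nonzero vector of the kernel
    supported in the circuit of [g], hence a multiple of [g]. *)
Lemma elementary_component S g i : elementary (ker A) g -> S \in P ->
  i \in S -> g i 0 != 0 -> supp g \subset S.
Proof.
move=> [kg g0 hg] SP iS gi.
have [|a ha] := hg _ (restrict_ker SP kg).
  by rewrite supp_restrict finset.subsetIl.
have a0 : a != 0.
  apply: contraNneq gi => a0; have := congr1 (fun M : 'cV[R]_n => M i 0) ha.
  by rewrite /= !mxE iS a0 mul0r => ->.
have := supp_restrict S g; rewrite ha supp_scale // => ->.
exact: finset.subsetIr.
Qed.

Lemma components_direct_sum : direct_sum (matroid_of A) P (linear_matroid A).
Proof.
split=> // [|I _]; first exact: components_partition.
rewrite /= /lin_indep finset.subsetT /=.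
apply/idP/forall_inP => [fI S SP|h].
  rewrite finset.subsetIr /=.
  have : lin_indep A [set: 'I_n]%SET (I :&: S)%SET.
    by apply: (@lin_indep_sub _ _ _ _ _ _ I); rewrite ?finset.subsetIl // /lin_indep finset.subsetT.
  by case/andP.
apply/free_colsP => g kg gI; apply/eqP; apply: contraT.
rewrite supp_neq0 => /finset.set0Pn[c cg].
have [S SP cS] := component_of c.
have /andP[_ /free_colsP fr] := h S SP.
have := fr _ (restrict_ker SP kg); rewrite supp_restrict => /(_ (finset.setSI S gI)) r0.
have : c \in supp (restrict S g) by rewrite supp_restrict inE cg cS.
by rewrite r0 in_supp mxE eqxx.
Qed.

(** A circuit meeting both parts of a separation is dependent, while its proper
    subsets, in particular its traces on the two parts, are independent. *)
Lemma component_nonseparable S : S \in P ->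
  (forall i j, i \in S -> j \in S -> i != j ->
     exists2 g, elementary (ker A) g & (g i 0 != 0) && (g j 0 != 0)) ->
  ~ separable (linear_matroid A S).
Proof.
move=> SP conn [S1 [S2 [/finset.set0Pn[i iS1] /finset.set0Pn[j jS2] US dis sep]]].
rewrite /= in US.
have iS : i \in S by rewrite -US inE iS1.
have jS : j \in S by rewrite -US inE jS2 orbT.
have jS1 : j \notin S1 by rewrite (disjointFl dis).
have iS2 : i \notin S2 by rewrite (disjointFr dis).
have ij : i != j by apply: contraNneq iS2 => ->.
have [g eg /andP[gi gj]] := conn i j iS jS ij.
have gS := elementary_component eg SP iS gi.
have [kg g0 hg] := eg.
(* a vector of the kernel supported on a part of the circuit is a multiple of
   [g], so it vanishes if this part misses an element of the circuit *)
have restricted (S' : {set 'I_n}) c : c \in supp g -> c \notin S' -> S' \subset S ->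
    indep (linear_matroid A S) (supp g :&: S')%SET.
  move=> cg cS' sS'; rewrite /= /lin_indep.
  rewrite (fintype.subset_trans (finset.subsetIr _ _)) //=.
  apply/free_colsP => h kh hs; apply/eqP; apply: contraT => h0.
  have [|a ha] := hg h kh; first exact: fintype.subset_trans hs (finset.subsetIl _ _).
  have a0 : a != 0 by apply: contraNneq h0 => a0; rewrite ha a0 scale0r.
  move: hs; rewrite ha supp_scale // => /fintype.subsetP/(_ c cg).
  by rewrite inE (negbTE cS') andbF.
have : indep (linear_matroid A S) (supp g).
  have jg : j \in supp g by rewrite in_supp.
  have ig : i \in supp g by rewrite in_supp.
  rewrite sep // (restricted _ _ jg jS1) ?(restricted _ _ ig iS2) //.
    by rewrite -US finset.subsetUr.
  by rewrite -US finset.subsetUl.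
rewrite /= /lin_indep gS /= => /free_colsP/(_ g kg (fintype.subxx _)) e0.
by rewrite e0 eqxx in g0.
Qed.

End Components.

Theorem theorem2p14 (R : realType) :
  exists (find_circuits : cmd) (c : nat),
  forall (m n : nat) (A : 'M[R]_(m, n)), row_free A ->
  exists (t : nat) (s : state R) (P : {set {set 'I_n}}) (Chat : seq {set 'I_n})
         (khat : 'I_n -> 'I_n -> R),
    exec find_circuits (input A) t s /\
    ((0 < m)%N -> (t <= c * (n ^ 2 * m ^ 2))%N) /\
    (returns_components s P /\ returns_family s Chat /\ returns_table s khat) /\
    (direct_sum (matroid_of A) P (linear_matroid A) /\
     (forall S, S \in P -> ~ separable (linear_matroid A S))) /\
    (forall C, C \in Chat -> circuit (matroid_of A) C) /\
    (forall S (i j : 'I_n), S \in P -> i \in S -> j \in S -> i != j ->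
       exists2 C, C \in Chat & (i \in C) && (j \in C)) /\
    (forall S (i j : 'I_n), S \in P -> i \in S -> j \in S -> i != j ->
       is_maximum (imbalances (ker A) Chat i j) (khat i j) /\
       khat i j <= kappa (ker A) i j <= kappa_star (ker A) ^+ 2 * khat i j).
Proof.
exists (compile find_circuits), (coef find_circuits * 16)%N => m n A fr.
set s := run find_circuits (input A).
have hd : has_dims m n (input A) by [].
have [t [ex le]] := compile_exec find_circuits_wf find_circuits_keeps_dims hd.
have [gs [T [[[fc fl] tab el] cov kT rowT]]] := find_circuits_spec fr.
rewrite -/s in fc fl tab cov rowT.
pose lab (j : 'I_n) := nmem s 1 0 j.
have conn S i j : S \in preim_partition lab [set: 'I_n]%SET -> i \in S -> j \in S ->
    i != j -> covers gs i j.
  by move=> SP iS jS ij; apply: cov => //; apply/esym/eqP; rewrite -(mem_component j SP iS).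
exists t, s, (preim_partition lab [set: 'I_n]%SET), (map (@supp R n) gs),
  (fun i j => rmem s 1 i j).
split; first exact: ex.
split.
  move=> m0; have n0 : (0 < n)%N.
    by apply: leq_trans m0 _; rewrite -(eqP fr) rank_leq_col.
  apply: leq_trans le _; have [-> ->] := find_circuits_deg.
  rewrite -mulnA leq_mul2l; apply/orP; right.
  (* as [m] and [n] are positive, [n + 1] and [m + 1] are at most twice as large *)
  have -> : (16 * (n ^ 2 * m ^ 2) = (2 * n) ^ 2 * (2 * m) ^ 2)%N by rewrite !expnMn; lia.
  by rewrite leq_mul // leq_exp2r //; lia.
split.
  split=> //; split=> //; split; first by rewrite size_map.
  by move=> k; rewrite size_map => ks; rewrite (nth_map 0) //; apply: fl.
split.
  split; first exact: components_direct_sum kT rowT.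
  move=> S SP; apply: (component_nonseparable kT rowT SP) => i j iS jS ij.
  by have [g hg gij] := conn S i j SP iS jS ij; exists g => //; apply: el.
split.
  by move=> _ /mapP[g hg ->]; apply/circuitP; exists g => //; apply: el.
split.
  move=> S i j SP iS jS ij; have [g hg gij] := conn S i j SP iS jS ij.
  by exists (supp g); rewrite ?map_f // !in_supp.
move=> S i j SP iS jS ij; have [g hg /andP[gi gj]] := conn S i j SP iS jS ij.
have [ub [K0|[h [hh hi hj hK]]]] := tab i j.
  have := ub g hg gi gj; rewrite K0 normr_le0 mulf_eq0 invr_eq0.
  by rewrite (negbTE gi) (negbTE gj).
have eh := el h hh; split; last first.
  by rewrite hK kappa_ge //= kappa_star_bound.
split.
  exists h, (supp h); rewrite map_f // !in_supp; split=> //; by case: eh.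
move=> _ [u [C [/mapP[v hv ->] iv jv [Wu su] ->]]].
rewrite !in_supp in iv jv.
by rewrite (elementary_ratio j (el v hv) Wu su) ?ub // -in_supp su in_supp.
Qed.
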